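(* Let $\zeta\colon\tilde P\to P$ be a $\Gamma$-structure over a classical $G$-structure $P(M,G)$. Then the generalized Kosmann lift $\xi_{\mathrm K}$ (on $P$) of a vector field $\xi$ on $M$ lifts to a unique ($\Gamma$-invariant) vector field $\tilde\xi_{\mathrm K}$ on $\tilde P$, which projects over $\xi_{\mathrm K}$.
   Context: $\Gamma$-structure: let $\rho\colon\Gamma\to G$ be a central homomorphism of a Lie group $\Gamma$ onto $G$, i.e. a surjective homomorphism whose kernel is discrete and contained in the centre of $\Gamma$. A $\Gamma$-structure on a principal bundle $P(M,G)$ is a principal bundle map $\zeta\colon\tilde P\to P$ from a principal $\Gamma$-bundle $\tilde P$ over $M$, covering $\mathrm{id}_M$, with $\zeta(\tilde u\cdot\alpha)=\zeta(\tilde u)\cdot\rho(\alpha)$ for all $\tilde u\in\tilde P$, $\alpha\in\Gamma$. Classical $G$-structure: let $m=\dim M$ and let $LM$ be the linear frame bundle, with structure group $H=GL(m,\mathbb R)$, $\mathfrak h=\mathfrak{gl}(m,\mathbb R)$. A Lie subgroup $G\subset H$ with Lie algebra $\mathfrak g$ is reductive if $\mathfrak h=\mathfrak g\oplus\mathfrak m$ for a vector subspace $\mathfrak m$ with $\mathrm{Ad}_a(\mathfrak m)\subset\mathfrak m$ for all $a\in G$; such an $\mathfrak m$ is fixed. A classical $G$-structure is a principal subbundle $P(M,G)$ of $LM$ over $M$ with $G$ a reductive Lie subgroup of $GL(m,\mathbb R)$. Generalized Kosmann lift: for $u\in P$ one has $T_u(LM)=T_uP\oplus\mathcal M_u$ with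 $\mathcal M_u=\{\frac{d}{dt}|_{t=0}u\cdot\exp(t\mu)\mid\mu\in\mathfrak m\}$. Let $L\xi:=\frac{\partial}{\partial t}L^1\varphi_t|_{t=0}$ be the natural lift of $\xi$ to $LM$, where $\{\varphi_t\}$ is the flow of $\xi$ and $L^1\varphi(j^1_0\epsilon)=j^1_0(\varphi\circ\epsilon)$. Then $\xi_{\mathrm K}$ is the $TP$-component of $L\xi|_P$; it is a $G$-invariant vector field on $P$. A vector field $\tilde\Xi$ on $\tilde P$ is a lift of (projects over) a vector field $\Xi$ on $P$ if $T\zeta\circ\tilde\Xi=\Xi\circ\zeta$. Invariance means being preserved by the tangent maps of all right translations by the structure group. *)

(* Defs.v *)
From HB Require Import structures.
From mathcomp Require Import all_boot all_order all_algebra.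
From mathcomp Require Import mathcomp_extra boolp classical_sets functions.
From mathcomp Require Import cardinality set_interval reals topology normedtype.
From mathcomp Require Import landau sequences derive.
Set Implicit Arguments. Unset Strict Implicit. Unset Printing Implicit Defensive.
Import Order.TTheory GRing.Theory Num.Theory numFieldNormedType.Exports.
Local Open Scope classical_set_scope.
Local Open Scope ring_scope.

Section Smooth.
Context {R : realType}.
Implicit Types E F : normedModType R.

(* f is C^k on U; meant for U open and E finite-dimensional, where iterated
   directional derivatives amount to partial derivatives *)
Fixpoint Ck {E F} (k : nat) (U : set E) (f : E -> F) : Prop :=
  if k is k'.+1 then
    (forall x, U x -> differentiable f x) /\
    (forall v, Ck k' U (fun x => 'D_v f x))
  else forall x, U x -> {for x, continuous f}.

Definition smooth_on {E F} (U : set E) (f : E -> F) := forall k, Ck k U f.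

Lemma near_eq_differentiable E F (f g : E -> F) (x : E) :
  (\near x, f x = g x) -> differentiable f x ->
  differentiable g x /\ 'd g x = 'd f x :> (E -> F).
Proof.
move=> fg df.
have c : continuous ('d f x) by exact: diff_continuous.
suff H : g \o shift x = cst (g x) + 'd f x +o_ 0 id.
  have e : 'd g x = 'd f x :> (E -> F) by exact: diff_unique.
  by split => //; apply/diff_locallyP; rewrite e.
have /eqaddoP fo := diff_locally df.
apply/eqaddoP => e e0; have := fo e e0.
have gfx : f x = g x by exact: (nbhs_singleton fg).
have : \forall h \near (0 : E), f (h + x) = g (h + x).
  by move: fg; rewrite (near_shift 0) /= subr0.
apply: filterS2 => h.
by rewrite !fctE /= => -> fgh; rewrite -gfx.
Qed.

Lemma open_near E (U : set E) x : open U -> U x -> \forall y \near x, U y.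
Proof. by move=> oU Ux; exact: open_nbhs_nbhs. Qed.

Lemma Ck_ext E F k (U : set E) (f g : E -> F) : open U ->
  (forall x, U x -> f x = g x) -> Ck k U f -> Ck k U g.
Proof.
move=> oU; elim: k f g => [|k IH] f g fg /=.
  move=> cf x Ux; change (g @ x --> g x); rewrite -fg//.
  apply: cvg_trans (cf x Ux); apply: near_eq_cvg.
  by near=> y; apply: fg; near: y; exact: open_near.
move=> [df Df]; split=> [x Ux|v].
  apply: (near_eq_differentiable _ (df x Ux)).1.
  by near=> y; apply: fg; near: y; exact: open_near.
apply: IH (Df v) => x Ux; apply: near_eq_derive.
by near=> y; apply: fg; near: y; exact: open_near.
Unshelve. all: by end_near. Qed.

Lemma CkW E F k (U : set E) (f : E -> F) : Ck k.+1 U f -> Ck k U f.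
Proof.
elim: k f => [|k IH] f; first by move=> [df _] x Ux; exact/differentiable_continuous/df.
by move=> [df Df]; split=> // v; exact/IH/Df.
Qed.

Lemma Ck_subset E F k (U V : set E) (f : E -> F) : U `<=` V -> Ck k V f -> Ck k U f.
Proof.
move=> UV; elim: k f => [|k IH] f /=; first by move=> + x /UV; apply.
by move=> [df Df]; split=> [x /UV/df//|v]; exact/IH/Df.
Qed.

Lemma Ck_cst E F k (U : set E) (a : F) : Ck k U (fun=> a).
Proof.
elim: k a => [|k IH] a /=; first by move=> x _; exact: cvg_cst.
split=> [x _|v]; first exact: differentiable_cst.
have -> : (fun x => 'D_v (fun=> a) x) = (fun=> 0) :> (E -> F).
  by apply/funext => x; exact: derive_cst.
exact: IH.
Qed.

Lemma Ck_lin E F k (U : set E) (f : {linear E -> F}) : continuous f -> Ck k U f.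
Proof.
move=> cf; case: k => [|k]; first by move=> x _; exact: cf.
split=> [x _|v]; first exact: linear_differentiable.
have -> : (fun x => 'D_v f x) = (fun=> f v).
  apply/funext => x; rewrite deriveE; last exact: linear_differentiable.
  by rewrite diff_lin.
exact: Ck_cst.
Qed.

Lemma Ck_id E k (U : set E) : Ck k U (@id E).
Proof. by apply: (@Ck_lin E E k U idfun) => x. Qed.

Lemma Ck_compl E F F' k (U : set E) (f : E -> F) (L : {linear F -> F'}) :
  open U -> continuous L -> Ck k U f -> Ck k U (fun x => L (f x)).
Proof.
move=> oU cL; elim: k f => [|k IH] f /=.
  by move=> cf x Ux; apply: continuous_comp; [exact: cf|exact: cL].
move=> [df Df]; split=> [x Ux|v].
  by apply: differentiable_comp; [exact: df|exact: linear_differentiable].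
apply: Ck_ext (IH _ (Df v)) => // x Ux.
have dL : differentiable L (f x) by exact: linear_differentiable.
rewrite [RHS]deriveE; last by apply: differentiable_comp => //; exact: df.
by rewrite (diff_comp (df x Ux) dL) /= (diff_lin _ cL) deriveE//; exact: df.
Qed.

Lemma Ck_precompl E E' F k (U : set E) (f : E -> F) (L : {linear E' -> E}) :
  open U -> continuous L -> Ck k U f -> Ck k (L @^-1` U) (fun x => f (L x)).
Proof.
move=> oU cL; elim: k f => [|k IH] f /=.
  by move=> cf x Ux; apply: continuous_comp; [exact: cL|exact: cf].
have oLU : open (L @^-1` U) by apply: open_comp => // x _; exact: cL.
move=> [df Df]; split=> [x Ux|v].
  by apply: differentiable_comp; [exact: linear_differentiable|exact: df].
apply: Ck_ext (IH _ (Df (L v))) => // x Ux.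
have dL : differentiable L x by exact: linear_differentiable.
rewrite [RHS]deriveE; last by apply: differentiable_comp => //; exact: df.
by rewrite (diff_comp dL (df _ Ux)) /= (diff_lin _ cL) deriveE//; exact: df.
Qed.

Lemma Ck_pair E F F' k (U : set E) (f : E -> F) (g : E -> F') : open U ->
  Ck k U f -> Ck k U g -> Ck k U (fun x => (f x, g x)).
Proof.
move=> oU; elim: k f g => [|k IH] f g /=.
  by move=> cf cg x Ux; apply: cvg_pair; [exact: cf|exact: cg].
move=> [df Df] [dg Dg]; split=> [x Ux|v].
  by apply: differentiable_pair; [exact: df|exact: dg].
apply: Ck_ext (IH _ _ (Df v) (Dg v)) => // x Ux.
rewrite [RHS]deriveE; last by apply: differentiable_pair; [exact: df|exact: dg].
rewrite (diff_pair (df x Ux) (dg x Ux)) !deriveE//; [exact: dg|exact: df].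
Qed.

Lemma Ck_add E F k (U : set E) (f g : E -> F) : open U ->
  Ck k U f -> Ck k U g -> Ck k U (fun x => f x + g x).
Proof.
move=> oU; elim: k f g => [|k IH] f g /=.
  by move=> cf cg x Ux; apply: cvgD; [exact: cf|exact: cg].
move=> [df Df] [dg Dg]; split=> [x Ux|v].
  by apply: differentiableD; [exact: df|exact: dg].
apply: Ck_ext (IH _ _ (Df v) (Dg v)) => // x Ux.
by rewrite -deriveD//; apply: diff_derivable; [exact: df|exact: dg].
Qed.

Lemma Ck_mul E k (U : set E) (f g : E -> R) : open U ->
  Ck k U f -> Ck k U g -> Ck k U (fun x => f x * g x).
Proof.
move=> oU; elim: k f g => [|k IH] f g.
  by move=> cf cg x Ux; apply: cvgM; [exact: cf|exact: cg].
move=> Cf Cg; have [df Df] := Cf; have [dg Dg] := Cg; split=> [x Ux|v].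
  by apply: differentiableM; [exact: df|exact: dg].
have := Ck_add oU (IH _ _ (CkW Cf) (Dg v)) (IH _ _ (CkW Cg) (Df v)).
apply: Ck_ext => // x Ux.
by rewrite -[RHS]/('D_v (f * g) x) deriveM//; apply: diff_derivable; [exact: df|exact: dg].
Qed.

Lemma Ck_sum E F k (U : set E) (I : Type) (r : seq I) (f : I -> E -> F) : open U ->
  (forall i, Ck k U (f i)) -> Ck k U (fun x => \sum_(i <- r) f i x).
Proof.
move=> oU Cf; elim: r => [|i r IH].
  by under eq_fun do rewrite big_nil; exact: Ck_cst.
by under eq_fun do rewrite big_cons; exact: Ck_add.
Qed.
End Smooth.

Record chart (R : realType) (E : normedModType R) (T : topologicalType) := Chart {
  cdom : set T;
  cmap : T -> E;
  cinv : E -> T;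
  cdom_open : open cdom;
  cimg_open : open (cmap @` cdom);
  cmapK : forall x, cdom x -> cinv (cmap x) = x;
  cmap_continuous : forall x, cdom x -> {for x, continuous cmap};
  cinv_continuous : forall y, (cmap @` cdom) y -> {for y, continuous cinv} }.

(* The model space E is finite-dimensional in all uses (column vectors, matrices,
   products of these); chart domains are then second countable, so that
   manifold_countable amounts to second countability. The atlas need not be
   maximal. chart_at is a choice of one chart around each point; through it the
   tangent space T_x T is identified with E. *)
HB.mixin Record isManifold (R : realType) (E : normedModType R) T
    & Topological T := {
  atlas : set (chart E T);
  chart_at : T -> chart E T;
  chart_at_atlas : forall x, atlas (chart_at x);
  chart_at_dom : forall x, cdom (chart_at x) x;
  atlas_smooth : forall c d, atlas c -> atlas d ->
    smooth_on (cmap c @` (cdom c `&` cdom d)) (cmap d \o cinv c);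
  manifold_hausdorff : hausdorff_space T;
  manifold_countable : exists2 A : set (chart E T), countable A &
    A `<=` atlas /\ \bigcup_(c in A) cdom c = setT }.

#[short(type="manifoldType")]
HB.structure Definition Manifold (R : realType) (E : normedModType R) :=
  {T of Topological T & isManifold R E T}.

Section Maps.
Context {R : realType} {E F : normedModType R}.
Context {M : manifoldType E} {N : manifoldType F}.

(* the condition on W makes f continuous at x *)
Definition msmooth_at (f : M -> N) (x : M) :=
  let c : chart E M := chart_at x in let d : chart F N := chart_at (f x) in
  exists W : set E, [/\ open W, W (cmap c x), W `<=` cmap c @` cdom c,
    (forall y, W y -> cdom d (f (cinv c y))) &
    smooth_on W (cmap d \o f \o cinv c)].

Definition msmooth_on (A : set M) (f : M -> N) := forall x, A x -> msmooth_at f x.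

Definition msmooth (f : M -> N) := forall x, msmooth_at f x.

(* the tangent map T_x f : T_x M -> T_(f x) N *)
Definition mdiff (f : M -> N) (x : M) : E -> F :=
  let c : chart E M := chart_at x in let d : chart F N := chart_at (f x) in
  'd (cmap d \o f \o cinv c) (cmap c x).
End Maps.

Lemma open_setX (T U : topologicalType) (A : set T) (B : set U) :
  open A -> open B -> open (A `*` B).
Proof.
move=> oA oB; rewrite (_ : A `*` B = fst @^-1` A `&` snd @^-1` B)//.
by apply: openI; apply: open_comp => // x _; [exact: cvg_fst|exact: cvg_snd].
Qed.

Lemma hausdorff_setX (T U : topologicalType) :
  hausdorff_space T -> hausdorff_space U -> hausdorff_space (T * U)%type.
Proof.
move=> hT hU p q cpq; rewrite [p]surjective_pairing [q]surjective_pairing.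
congr (_, _).
  apply: hT => A B pA qB; have [| |z [Az Bz]] := cpq (fst @^-1` A) (fst @^-1` B).
  - exact: (cvg_fst pA).
  - exact: (cvg_fst qB).
  - by exists z.1.
apply: hU => A B pA qB; have [| |z [Az Bz]] := cpq (snd @^-1` A) (snd @^-1` B).
- exact: (cvg_snd pA).
- exact: (cvg_snd qB).
- by exists z.2.
Qed.

Lemma chart_open (R : realType) (G : normedModType R) (T : topologicalType) (c : chart G T) A :
  open A -> open (cmap c @` (cdom c `&` A)).
Proof.
move=> oA; rewrite openE => _ [x [cx Ax] <-]; rewrite /interior.
near=> y.
have [z cz zy] : (cmap c @` cdom c) y.
  by near: y; apply: open_nbhs_nbhs; split; [exact: cimg_open|exists x].
exists z => //; split=> //; rewrite -(cmapK cz) zy.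
near: y; have /(_ _ _) := @cinv_continuous _ _ _ c (cmap c x).
apply; first by exists x.
by apply: open_nbhs_nbhs; split=> //; rewrite cmapK.
Unshelve. all: by end_near. Qed.

Section ProductManifold.
Context {R : realType} {E F : normedModType R}.

Section chart.
Context {T U : topologicalType} (c : chart E T) (d : chart F U).
Let dom := cdom c `*` cdom d.
Let map (z : T * U) := (cmap c z.1, cmap d z.2).
Let inv (z : E * F) := (cinv c z.1, cinv d z.2).

Lemma image_setX (A : set T) (B : set U) :
  map @` (A `*` B) = (cmap c @` A) `*` (cmap d @` B).
Proof.
apply/seteqP; split => [_ [z [Az Bz] <-]|[a b] [/= [x Ax <-] [y By <-]]].
  by split=> /=; [exists z.1|exists z.2].
by exists (x, y).
Qed.

Let open_img : open (map @` dom).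
Proof. by rewrite image_setX; apply: open_setX; exact: cimg_open. Qed.

Let mapK x : dom x -> inv (map x) = x.
Proof. by case: x => x y [/= cx dy]; rewrite /inv /= !cmapK. Qed.

Let map_cont x : dom x -> {for x, continuous map}.
Proof.
move=> [cx dx]; apply: cvg_pair.
  by apply: (@continuous_comp _ _ _ fst); [exact: cvg_fst|exact: cmap_continuous].
by apply: (@continuous_comp _ _ _ snd); [exact: cvg_snd|exact: cmap_continuous].
Qed.

Let inv_cont y : (map @` dom) y -> {for y, continuous inv}.
Proof.
rewrite image_setX => -[cx dx]; apply: cvg_pair.
  by apply: (@continuous_comp _ _ _ fst); [exact: cvg_fst|exact: cinv_continuous].
by apply: (@continuous_comp _ _ _ snd); [exact: cvg_snd|exact: cinv_continuous].
Qed.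

Definition prod_chart : chart (E * F)%type (T * U)%type :=
  Chart (open_setX (cdom_open c) (cdom_open d)) open_img mapK map_cont inv_cont.
End chart.

Context {M : manifoldType E} {N : manifoldType F}.

Definition prod_atlas : set (chart (E * F)%type (M * N)%type) :=
  [set prod_chart z.1 z.2 | z in atlas `*` atlas].

Definition prod_chart_at (x : M * N) := prod_chart (chart_at x.1) (chart_at x.2).

Let at_atlas x : prod_atlas (prod_chart_at x).
Proof. by exists (chart_at x.1, chart_at x.2) => //; split; exact: chart_at_atlas. Qed.

Let at_dom x : cdom (prod_chart_at x) x.
Proof. by split; exact: chart_at_dom. Qed.

Let atlas_sm c d : prod_atlas c -> prod_atlas d ->
  smooth_on (cmap c @` (cdom c `&` cdom d)) (cmap d \o cinv c).
Proof.
move=> [[c1 c2] [/= a1 a2] <-] [[d1 d2] [/= b1 b2] <-] k.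
set U1 := cmap c1 @` (cdom c1 `&` cdom d1).
set U2 := cmap c2 @` (cdom c2 `&` cdom d2).
have o1 : open U1 by apply: chart_open; exact: cdom_open.
have o2 : open U2 by apply: chart_open; exact: cdom_open.
have -> : cmap (prod_chart c1 c2) @`
    (cdom (prod_chart c1 c2) `&` cdom (prod_chart d1 d2)) = U1 `*` U2.
  by rewrite -image_setX; congr (_ @` _); apply/seteqP; split=> -[x y] [[? ?] [? ?]].
have cf : continuous (fst : E * F -> E) by move=> z; exact: cvg_fst.
have cs : continuous (snd : E * F -> F) by move=> z; exact: cvg_snd.
have s1 := Ck_precompl (L := fst) o1 cf (atlas_smooth _ _ a1 b1 k).
have s2 := Ck_precompl (L := snd) o2 cs (atlas_smooth _ _ a2 b2 k).
apply: (Ck_pair (open_setX o1 o2)); [apply: Ck_subset s1|apply: Ck_subset s2];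
  by move=> z [].
Qed.

Let prod_countable : exists2 A : set (chart (E * F)%type (M * N)%type), countable A &
  A `<=` prod_atlas /\ \bigcup_(c in A) cdom c = setT.
Proof.
have [A cA [Aa AT]] := @manifold_countable R E M.
have [B cB [Ba BT]] := @manifold_countable R F N.
exists [set prod_chart z.1 z.2 | z in A `*` B].
  by apply: sub_countable (card_image_le _ _) _; exact: countableX.
split; first by move=> _ [z [/Aa ? /Ba ?] <-]; exists z.
rewrite -subTset => -[x y] _.
have [c Ac cx] : (\bigcup_(c in A) cdom c) x by rewrite AT.
have [d Bd dy] : (\bigcup_(c in B) cdom c) y by rewrite BT.
by exists (prod_chart c d) => //; exists (c, d).
Qed.

HB.instance Definition _ := isManifold.Build R (E * F)%type (M * N)%type
  at_atlas at_dom atlas_sm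
  (hausdorff_setX manifold_hausdorff manifold_hausdorff) prod_countable.
End ProductManifold.

Section Flat.
Context {R : realType} (E : normedModType R).

Let open_img : open (@id E @` setT).
Proof. by rewrite image_id; exact: openT. Qed.

Definition id_chart : chart E E :=
  @Chart R E E setT id id openT open_img (fun _ _ => erefl)
    (fun x _ => (fun A => id) : {for x, continuous id})
    (fun x _ => (fun A => id) : {for x, continuous id}).

Definition flat_chart_at (x : E) := id_chart.

Lemma flat_at x : [set id_chart] (flat_chart_at x).
Proof. by []. Qed.

Lemma flat_dom x : cdom (flat_chart_at x) x.
Proof. by []. Qed.

Lemma flat_smooth c d : [set id_chart] c -> [set id_chart] d ->
  smooth_on (cmap c @` (cdom c `&` cdom d)) (cmap d \o cinv c).
Proof. by move=> -> -> k; exact: Ck_id. Qed.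

Lemma flat_countable : exists2 A : set (chart E E), countable A &
  A `<=` [set id_chart] /\ \bigcup_(c in A) cdom c = setT.
Proof.
exists [set id_chart]; first exact: countable1.
by split=> //; rewrite bigcup_set1.
Qed.
End Flat.

(* normed spaces as manifolds, with the identity as only chart *)
HB.instance Definition _ (R : realType) :=
  isManifold.Build R R^o R^o (@flat_at R R^o) (@flat_dom R R^o) (@flat_smooth R R^o)
    (@norm_hausdorff _ R^o) (@flat_countable R R^o).

HB.instance Definition _ (R : realType) m n :=
  isManifold.Build R 'M[R]_(m, n) 'M[R]_(m, n)
    (@flat_at R 'M[R]_(m, n)) (@flat_dom R 'M[R]_(m, n))
    (@flat_smooth R 'M[R]_(m, n)) (@norm_hausdorff _ 'M[R]_(m, n))
    (@flat_countable R 'M[R]_(m, n)).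

Section Linear.
Variables (R : realType) (m n : nat).

Lemma coord_is_linear i j : linear (fun A : 'M[R]_(m, n) => A i j : R^o).
Proof. by move=> a A B; rewrite !mxE. Qed.

Definition coordl i j : {linear 'M[R]_(m, n) -> R^o} :=
  HB.pack (fun A : 'M[R]_(m, n) => A i j : R^o)
    (GRing.isLinear.Build _ _ _ _ _ (coord_is_linear i j)).

Lemma scalel_is_linear (A : 'M[R]_(m, n)) : linear (fun a : R^o => a *: A).
Proof. by move=> a b c; rewrite scalerDl scalerA. Qed.

Definition scalel (A : 'M[R]_(m, n)) : {linear R^o -> 'M[R]_(m, n)} :=
  HB.pack (fun a : R^o => a *: A)
    (GRing.isLinear.Build _ _ _ _ _ (scalel_is_linear A)).
End Linear.

Section Transition.
Context {R : realType} {E : normedModType R} {M : manifoldType E}.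
Implicit Types (c d : chart E M) (x : M).

(* change of coordinates on T_x M from the chart c to the chart d *)
Definition tchange c d x : {linear E -> E} := 'd (cmap d \o cinv c) (cmap c x).

Lemma transition_differentiable c d x : atlas c -> atlas d -> cdom c x -> cdom d x ->
  differentiable (cmap d \o cinv c) (cmap c x).
Proof. by move=> ac ad cx dx; have [+ _] := atlas_smooth _ _ ac ad 1; apply; exists x. Qed.

Lemma overlap_open c d : open (cmap c @` (cdom c `&` cdom d)).
Proof. by apply: chart_open; exact: cdom_open. Qed.

Lemma tchange_id c x : cdom c x -> tchange c c x = id :> (E -> E).
Proof.
move=> cx; have -> : id = 'd (@id E) (cmap c x) :> (E -> E).
  by apply/esym; apply: (@diff_lin _ _ _ idfun) => y.
apply: (near_eq_differentiable _ _).2; last exact: ex_diff.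
near=> y; have [z cz <-] : (cmap c @` cdom c) y.
  by near: y; apply: open_near; [exact: cimg_open|exists x].
by rewrite /= cmapK.
Unshelve. all: by end_near. Qed.

Lemma tchange_comp c d e x : atlas c -> atlas d -> atlas e ->
  cdom c x -> cdom d x -> cdom e x ->
  forall v, tchange d e x (tchange c d x v) = tchange c e x v.
Proof.
move=> ac ad ae cx dx ex v.
have dcd := transition_differentiable ac ad cx dx.
have dde := transition_differentiable ad ae dx ex.
have dde' : differentiable (cmap e \o cinv d) ((cmap d \o cinv c) (cmap c x)).
  by rewrite /= cmapK.
have H : \forall y \near cmap c x,
    ((cmap e \o cinv d) \o (cmap d \o cinv c)) y = (cmap e \o cinv c) y.
  near=> y; have [z [cz dz] <-] : (cmap c @` (cdom c `&` cdom d)) y.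
    by near: y; apply: open_near; [exact: overlap_open|exists x].
  by rewrite /= !cmapK// cmapK.
have [_ H'] := near_eq_differentiable H (differentiable_comp dcd dde').
have H2 := congr1 (@^~ v) (etrans H' (diff_comp dcd dde')).
rewrite /tchange; apply/esym; apply: etrans H2 _.
have -> // : cmap d x = (cmap d \o cinv c) (cmap c x) by rewrite /= cmapK.
Unshelve. all: by end_near. Qed.

Lemma tchangeK c d x : atlas c -> atlas d -> cdom c x -> cdom d x ->
  cancel (tchange c d x) (tchange d c x).
Proof. by move=> ac ad cx dx v; rewrite tchange_comp// tchange_id. Qed.
End Transition.

Section Mapcols.
Context {R : realType} {m : nat}.
Implicit Types (L : 'cV[R]_m -> 'cV[R]_m) (e : 'M[R]_m).

(* L composed with the linear map of matrix e *)
Definition mapcols L e : 'M[R]_m := \matrix_(i, j) L (col j e) i 0.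

Lemma col_mapcols L e j : col j (mapcols L e) = L (col j e).
Proof. by apply/matrixP => i k; rewrite !mxE ord1. Qed.

Lemma eq_mapcols L L' e : (forall v, L v = L' v) -> mapcols L e = mapcols L' e.
Proof. by move=> LL; apply/matrixP => i j; rewrite !mxE LL. Qed.

Lemma mapcols_comp L L' e : mapcols L (mapcols L' e) = mapcols (L \o L') e.
Proof. by apply/matrixP => i j; rewrite !mxE col_mapcols. Qed.

Lemma mapcols_id e : mapcols id e = e.
Proof. by apply/matrixP => i j; rewrite !mxE. Qed.

Lemma mapcolsE (L : {linear 'cV[R]_m -> 'cV[R]_m}) e :
  mapcols L e = \sum_i \sum_j \sum_k
    (e k j * L (delta_mx k 0) i 0) *: delta_mx i j.
Proof.
rewrite [LHS]matrix_sum_delta; apply: eq_bigr => i _; apply: eq_bigr => j _.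
rewrite -scaler_suml; congr (_ *: _); rewrite mxE (matrix_sum_delta (col j e)).
rewrite linear_sum summxE; apply: eq_bigr => k _.
by rewrite big_ord1 linearZ !mxE.
Qed.

Lemma mapcols_mul (L : {linear 'cV[R]_m -> 'cV[R]_m}) e :
  mapcols L e = mapcols L 1%:M *m e.
Proof.
apply/matrixP => i j; rewrite !mxE (matrix_sum_delta (col j e)).
rewrite linear_sum summxE; apply: eq_bigr => k _.
rewrite big_ord1 linearZ !mxE mulrC; congr (L _ _ _ * _).
by apply/matrixP => a b; rewrite !mxE ord1 eqxx andbT.
Qed.

Lemma mapcols_unit (L L' : {linear 'cV[R]_m -> 'cV[R]_m}) e : cancel L L' ->
  e \in unitmx -> mapcols L e \in unitmx.
Proof.
move=> LK eu; rewrite mapcols_mul unitmx_mul eu andbT.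
have : mapcols L' (mapcols L 1%:M) = 1%:M.
  by rewrite mapcols_comp -[RHS]mapcols_id; exact: eq_mapcols.
by rewrite mapcols_mul => /mulmx1_unit[].
Qed.

Lemma Ck_coord m' n k (U : set 'M[R]_(m', n)) i j : Ck k U (fun A => A i j : R).
Proof.
have := @Ck_lin R _ _ k U (@coordl R m' n i j) (@coord_continuous R m' n i j).
exact.
Qed.

Lemma open_unitmx : open [set e : 'M[R]_m | e \in unitmx].
Proof.
have -> : [set e : 'M[R]_m | e \in unitmx] = determinant @^-1` [set x : R | x != 0].
  by apply/seteqP; split=> e /=; rewrite unitmxE unitfE.
apply: open_comp; last exact: open_neq.
move=> A _; have : forall k, Ck k setT (fun A : 'M[R]_m => \det A).
  move=> k.
  apply: Ck_sum => [|s]; first exact: openT.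
  apply: Ck_mul; [exact: openT|exact: Ck_cst|].
  elim: (index_enum _) => [|i r IH].
    by under eq_fun do rewrite big_nil; exact: Ck_cst.
  under eq_fun do rewrite big_cons.
  by apply: Ck_mul IH; [exact: openT|exact: Ck_coord].
by move=> /(_ 0 A I).
Qed.
End Mapcols.

Section FrameBundle.
Context {R : realType} {m : nat} (M : manifoldType 'cV[R]_m).

(* The linear frame bundle LM: a frame at x is a linear isomorphism R^m -> T_x M,
   stored as its invertible matrix in the chart chart_at x. The 1-jet j^1_0 eps
   of a local diffeomorphism eps : R^m -> M is the frame (eps 0, T_0 eps). The
   topology and the smooth structure do not come from the product M x GL(m): they
   are those of the bundle charts frame_map c, for c a chart of M. *)
Definition frame : Type := {u : M * 'M[R]_m | u.2 \in unitmx}.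

HB.instance Definition _ := gen_eqMixin frame.
HB.instance Definition _ := gen_choiceMixin frame.

Definition fbase (u : frame) : M := (sval u).1.
Definition fmx (u : frame) : 'M[R]_m := (sval u).2.

(* the frame e at x if e is invertible; the default is otherwise irrelevant *)
Definition mkframe (x : M) (e : 'M[R]_m) : frame :=
  insubd (exist (fun u : M * 'M[R]_m => u.2 \in unitmx) (x, 1%:M) (unitmx1 R m)) (x, e).

Lemma fmx_unit u : fmx u \in unitmx.
Proof. exact: (svalP u). Qed.

Lemma frame_inj u v : fbase u = fbase v -> fmx u = fmx v -> u = v.
Proof.
case: u v => [[x e] eu] [[y f] fu]; rewrite /fbase /fmx /= => xy ef.
by apply: val_inj; rewrite /= xy ef.
Qed.

Lemma fbase_mk x e : fbase (mkframe x e) = x.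
Proof. by rewrite /fbase /mkframe -[sval _]/(val _) val_insubd; case: ifP. Qed.

Lemma fmx_mk x e : e \in unitmx -> fmx (mkframe x e) = e.
Proof. by move=> eu; rewrite /fmx /mkframe -[sval _]/(val _) val_insubd /= eu. Qed.

Implicit Types c d : chart 'cV[R]_m M.
Local Notation EF := ('cV[R]_m * 'M[R]_m)%type.

Definition frame_dom c : set frame := [set u | cdom c (fbase u)].

Definition frame_map c (u : frame) : EF :=
  (cmap c (fbase u), mapcols (tchange (chart_at (fbase u)) c (fbase u)) (fmx u)).

Definition frame_inv c (z : EF) : frame :=
  let x := cinv c z.1 in mkframe x (mapcols (tchange c (chart_at x) x) z.2).

Lemma frame_mapK c u : atlas c -> frame_dom c u -> frame_inv c (frame_map c u) = u.
Proof.
move=> ac cu; rewrite /frame_inv /frame_map /= cmapK// mapcols_comp.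
have -> : mapcols (tchange c (chart_at (fbase u)) (fbase u) \o
    tchange (chart_at (fbase u)) c (fbase u)) (fmx u) = fmx u.
  rewrite -[RHS]mapcols_id; apply: eq_mapcols => v /=.
  by rewrite tchangeK//; [exact: chart_at_atlas|exact: chart_at_dom].
by apply: frame_inj; rewrite ?fbase_mk// fmx_mk// fmx_unit.
Qed.

Lemma frame_imgE c (A : set M) : atlas c ->
  frame_map c @` (frame_dom c `&` fbase @^-1` A) =
  (cmap c @` (cdom c `&` A)) `*` [set e | e \in unitmx].
Proof.
move=> ac; apply/seteqP; split=> [_ [u [cu Au] <-]|[y e] [/= [x [cx Ax] <-] eu]].
  split=> /=; first by exists (fbase u).
  apply: mapcols_unit (fmx_unit u).
  by apply: tchangeK => //; [exact: chart_at_atlas|exact: chart_at_dom].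
exists (frame_inv c (cmap c x, e)).
  by rewrite /frame_dom /frame_inv /= fbase_mk cmapK.
rewrite /frame_inv /frame_map /= !fbase_mk cmapK// fmx_mk.
  rewrite mapcols_comp; congr (_, _); rewrite -[RHS]mapcols_id.
  apply: eq_mapcols => v /=.
  by rewrite tchangeK//; [exact: chart_at_atlas|exact: chart_at_dom].
apply: mapcols_unit eu.
by apply: tchangeK => //; [exact: chart_at_atlas|exact: chart_at_dom].
Qed.

Lemma frame_img_open c (A : set M) : atlas c -> open A ->
  open (frame_map c @` (frame_dom c `&` fbase @^-1` A)).
Proof.
move=> ac oA; rewrite frame_imgE//; apply: open_setX; last exact: open_unitmx.
exact: chart_open.
Qed.

(* frame coordinates in c to those in d: (y, e) |-> (tau y, J tau(y) e) *)
Definition frame_trans c d (z : EF) : EF :=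
  (cmap d (cinv c z.1), mapcols ('d (cmap d \o cinv c) (z.1)) z.2).

Lemma frame_transE c d u : atlas c -> atlas d -> frame_dom c u -> frame_dom d u ->
  frame_trans c d (frame_map c u) = frame_map d u.
Proof.
move=> ac ad cu du; rewrite /frame_trans -[(frame_map c u).1]/(cmap c (fbase u)).
rewrite cmapK//; congr (_, _).
rewrite -[(frame_map c u).2]/(mapcols (tchange _ c (fbase u)) (fmx u)).
apply: etrans (mapcols_comp _ _ _) _; apply: eq_mapcols => v.
exact: (tchange_comp (chart_at_atlas _) ac ad (chart_at_dom _) cu du v).
Qed.

Lemma frame_trans_smooth c d : atlas c -> atlas d ->
  smooth_on ((cmap c @` (cdom c `&` cdom d)) `*` [set e | e \in unitmx]) (frame_trans c d).
Proof.
move=> ac ad k; set U := cmap c @` _.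
have oU : open U by exact: overlap_open.
have oUX : open (U `*` [set e : 'M[R]_m | e \in unitmx]).
  by apply: open_setX => //; exact: open_unitmx.
have cf : continuous (fst : EF -> 'cV[R]_m) by move=> z; exact: cvg_fst.
have cs : continuous (snd : EF -> 'M[R]_m) by move=> z; exact: cvg_snd.
have [tdiff tD] := atlas_smooth _ _ ac ad k.+1.
apply: Ck_pair => //.
  have := Ck_precompl (L := fst) oU cf (atlas_smooth _ _ ac ad k).
  by apply: Ck_subset => z [].
pose g (z : EF) := \sum_i \sum_j \sum_l
  (z.2 l j * 'D_(delta_mx l 0) (cmap d \o cinv c) z.1 i 0) *: delta_mx i j : 'M[R]_m.
apply: (@Ck_ext _ _ _ _ _ g) => // [z [Uz _]|].
  rewrite mapcolsE; apply: eq_bigr => i _; apply: eq_bigr => j _.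
  by apply: eq_bigr => l _; rewrite deriveE//; exact: tdiff.
apply: Ck_sum => // i; apply: Ck_sum => // j; apply: Ck_sum => // l.
apply: (Ck_compl (L := scalel (delta_mx i j))) => //; first exact: scalel_continuous.
apply: Ck_mul => //.
  have := Ck_precompl (L := snd) openT cs (@Ck_coord R m m k setT l j).
  by apply: Ck_subset => z _.
have tDi := Ck_compl (L := @coordl R m 1 i 0) oU (@coord_continuous R m 1 i 0) (tD (delta_mx l 0)).
have := Ck_precompl (L := fst) oU cf tDi.
by apply: Ck_subset => z [].
Qed.
Lemma frame_map_inj c u v : atlas c -> frame_dom c u -> frame_dom c v ->
  frame_map c u = frame_map c v -> u = v.
Proof. by move=> ac cu cv uv; rewrite -(frame_mapK ac cu) uv frame_mapK. Qed.

Definition frame_op (B : set frame) :=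
  forall c, atlas c -> open (frame_map c @` (frame_dom c `&` B)).

Let frame_opT : frame_op setT.
Proof. by move=> c ac; exact: (@frame_img_open c setT ac openT). Qed.

Let frame_opI : setI_closed frame_op.
Proof.
move=> A B oA oB c ac.
rewrite (_ : _ @` _ = (frame_map c @` (frame_dom c `&` A)) `&`
  (frame_map c @` (frame_dom c `&` B))); first exact: openI (oA c ac) (oB c ac).
apply/seteqP; split=> [_ [u [cu [Au Bu]] <-]|_ [[u [cu Au] <-] [v [cv Bv] vu]]].
  by split; exists u.
by exists u => //; split=> //; split=> //; rewrite -(frame_map_inj ac cv cu vu).
Qed.

Let frame_opU (I : Type) (f : I -> set frame) : (forall i, frame_op (f i)) ->
  frame_op (\bigcup_i f i).
Proof.
move=> of_ c ac; rewrite (_ : _ @` _ =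
  \bigcup_i (frame_map c @` (frame_dom c `&` f i))); last first.
  by rewrite setI_bigcupr image_bigcup.
by apply: bigcup_open => i _; exact: of_.
Qed.

HB.instance Definition _ := isOpenTopological.Build frame frame_opT frame_opI frame_opU.

Lemma frame_openE (B : set frame) : open B = frame_op B.
Proof. by []. Qed.

Lemma fbase_continuous : continuous fbase.
Proof.
apply/continuousP => A oA; rewrite frame_openE => c ac; exact: frame_img_open.
Qed.

Section chart.
Context {c : chart 'cV[R]_m M} (ac : atlas c).

Let dom_open : open (frame_dom c).
Proof.
by apply: (@open_comp _ _ fbase) => [x _|]; [exact: fbase_continuous|exact: cdom_open].
Qed.

Let img_open : open (frame_map c @` frame_dom c).
Proof. by rewrite -[frame_dom c]setIT; exact: frame_opT. Qed.

Lemma frame_preim_open (W : set EF) : open W ->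
  open (frame_dom c `&` frame_map c @^-1` W).
Proof.
move=> oW; rewrite frame_openE => d ad.
set V := (cmap d @` (cdom d `&` cdom c)) `*` [set e : 'M[R]_m | e \in unitmx].
have oV : open V by apply: open_setX; [exact: overlap_open|exact: open_unitmx].
rewrite (_ : _ @` _ = V `&` frame_trans d c @^-1` W).
  rewrite openE => z [Vz Wz]; apply: filterI.
    by apply: open_nbhs_nbhs; split.
  have cz := frame_trans_smooth ad ac 0 z Vz.
  by apply: cz; apply: open_nbhs_nbhs; split.
rewrite /V -frame_imgE//; apply/seteqP; split=> [_ [u [du [cu Wu]] <-]|].
  by split; [exists u|rewrite /= frame_transE].
move=> _ [[u [du cu] <-]]; rewrite /= frame_transE// => Wu; exists u => //.
Qed.

Let map_cont u : frame_dom c u -> {for u, continuous (frame_map c)}.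
Proof.
move=> cu A; rewrite nbhsE => -[W [oW Wu] WA].
rewrite nbhsE; exists (frame_dom c `&` frame_map c @^-1` W); last by move=> v [_ /WA].
split; [exact: frame_preim_open|split]; [exact: cu|exact: Wu].
Qed.

Let inv_cont z : (frame_map c @` frame_dom c) z -> {for z, continuous (frame_inv c)}.
Proof.
move=> [u cu <-] A; rewrite nbhsE frame_mapK// => -[B [oB Bu] BA].
rewrite nbhsE; exists (frame_map c @` (frame_dom c `&` B)).
  by split; [exact: oB|exists u].
by move=> _ [v [cv Bv] <-] /=; rewrite frame_mapK//; exact: BA.
Qed.

Definition frame_chart : chart EF frame :=
  Chart dom_open img_open (fun u => @frame_mapK c u ac) map_cont inv_cont.
End chart.

Definition frame_atlas : set (chart EF frame) :=
  [set f | exists c (ac : atlas c), f = frame_chart ac].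

Definition frame_chart_at (u : frame) := frame_chart (chart_at_atlas (fbase u)).

Let at_atlas u : frame_atlas (frame_chart_at u).
Proof. by exists (chart_at (fbase u)), (chart_at_atlas (fbase u)). Qed.

Let at_dom u : cdom (frame_chart_at u) u.
Proof. exact: chart_at_dom. Qed.

Let frame_smooth f g : frame_atlas f -> frame_atlas g ->
  smooth_on (cmap f @` (cdom f `&` cdom g)) (cmap g \o cinv f).
Proof.
move=> [c [ac ->]] [d [ad ->]] k.
have oI : open (frame_map c @` (frame_dom c `&` frame_dom d)).
  by apply: (frame_img_open ac); exact: cdom_open.
apply: (Ck_ext oI (f := frame_trans c d)).
  by move=> _ [u [cu du] <-]; rewrite /= frame_transE// frame_mapK.
by have := frame_trans_smooth ac ad k; rewrite -frame_imgE.
Qed.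

Let frame_hausdorff : hausdorff_space frame.
Proof.
rewrite open_hausdorff => u v uv; have [buv|] := eqVneq (fbase u) (fbase v).
  have ac := chart_at_atlas (fbase u).
  have cu : frame_dom (chart_at (fbase u)) u by exact: chart_at_dom.
  have cv : frame_dom (chart_at (fbase u)) v by rewrite /frame_dom /= -buv.
  have : frame_map (chart_at (fbase u)) u != frame_map (chart_at (fbase u)) v.
    by apply: contraNneq uv => /(frame_map_inj ac cu cv) ->.
  have := @norm_hausdorff _ EF; rewrite open_hausdorff => H /H[[A B]].
  rewrite /= !inE => -[Au Bv] [oA oB AB].
  pose D (W : set EF) := frame_dom (chart_at (fbase u)) `&` frame_map (chart_at (fbase u)) @^-1` W.
  exists (D A, D B) => /=; first by rewrite !inE.
  split; [exact: frame_preim_open|exact: frame_preim_open|].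
  apply/eqP; rewrite -subset0 => w [[_ Aw] [_ Bw]].
  by have : (A `&` B) (frame_map (chart_at (fbase u)) w) by []; rewrite AB.
have := @manifold_hausdorff R _ M; rewrite open_hausdorff => H /H[[A B]].
rewrite /= !inE => -[Au Bv] [oA oB AB].
exists (fbase @^-1` A, fbase @^-1` B) => /=; first by rewrite !inE.
split; [| |by apply/eqP; rewrite -preimage_setI AB preimage_set0];
  by apply: open_comp => // x _; exact: fbase_continuous.
Qed.

Let frame_countable : exists2 A : set (chart EF frame), countable A &
  A `<=` frame_atlas /\ \bigcup_(c in A) cdom c = setT.
Proof.
have [A cA [Aa AT]] := @manifold_countable R _ M.
pose h c := if pselect (atlas c) is left ac then [set frame_chart ac] else set0.
exists (\bigcup_(c in A) h c).
  apply: bigcup_countable => // c _; rewrite /h; case: pselect => [ac|nac].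
    exact: countable1.
  exact: countable0.
split.
  move=> f [c Ac]; rewrite /h; case: pselect => // ac ->; by exists c, ac.
rewrite -subTset => u _.
have [c Ac cu] : (\bigcup_(c in A) cdom c) (fbase u) by rewrite AT.
have ac := Aa _ Ac; exists (frame_chart ac) => //.
exists c => //; rewrite /h; case: pselect => // ac'.
by rewrite /= (Prop_irrelevance ac ac').
Qed.

HB.instance Definition _ := isManifold.Build R EF frame
  at_atlas at_dom frame_smooth frame_hausdorff frame_countable.
End FrameBundle.

(* A vector field on M is a map X : M -> E, where X x is a tangent vector at x
   expressed in the chart chart_at x. *)
Section VectorFields.
Context {R : realType} {E : normedModType R} {M : manifoldType E}.

Definition vf_in_chart (c : chart E M) (X : M -> E) (y : E) : E :=
  let x := cinv c y in tchange (chart_at x) c x (X x).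

Definition smooth_vf (X : M -> E) :=
  forall c, atlas c -> smooth_on (cmap c @` cdom c) (vf_in_chart c X).

(* gamma'(t) *)
Definition velocity (gamma : R -> M) (t : R) : E :=
  derive1 (cmap (chart_at (gamma t) : chart E M) \o gamma) t.

(* phi is a local flow of X, with flow domain D; phi t x is arbitrary for (t, x)
   outside D *)
Definition is_flow (X : M -> E) (phi : R -> M -> M) :=
  exists D : set (R^o * M), [/\ open D,
    forall x, D (0, x),
    forall x, is_interval [set t : R | D (t, x)],
    msmooth_on D (fun z : R^o * M => phi z.1 z.2) &
    (forall x, phi 0 x = x) /\
    (forall t x, D (t, x) -> velocity (phi ^~ x) t = X (phi t x))].

(* Every smooth vector field has a flow and two flows coincide near {0} x M; only
   this germ matters below. The default value serves only to make flow total. *)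
Definition flow (X : M -> E) : R -> M -> M :=
  xget ((fun _ x => x) : R -> M -> M) [set phi | is_flow X phi].
End VectorFields.

HB.mixin Record isLieGroup (R : realType) (E : normedModType R) G
    & Manifold R E G & Group G := {
  lie_mul_smooth : msmooth (fun z : G * G => (z.1 * z.2)%g);
  lie_inv_smooth : msmooth (fun a : G => (a^-1)%g) }.

#[short(type="lieGroupType")]
HB.structure Definition LieGroup (R : realType) (E : normedModType R) :=
  {G of Manifold R E G & Group G & isLieGroup R E G}.

Section PrincipalBundles.
Context {R : realType} {E F EP : normedModType R}.
Context {M : manifoldType E} {G : lieGroupType F} {P : manifoldType EP}.

(* a right action preserving the fibres, with equivariant local trivializations
   u |-> (pi u, s u) from pi^-1(U) onto U x G, of smooth inverse r; freeness,
   transitivity on the fibres and surjectivity of pi follow *)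
Definition principal_bundle (pi : P -> M) (act : P -> G -> P) :=
  [/\ msmooth pi, msmooth (fun z : P * G => act z.1 z.2),
      (forall u, act u 1%g = u) /\
      (forall u a b, act u (a * b)%g = act (act u a) b),
      (forall u a, pi (act u a) = pi u) &
      forall x : M, exists (U : set M) (s : P -> G) (r : M * G -> P),
        [/\ open U /\ U x,
            msmooth_on (pi @^-1` U) s /\ msmooth_on (U `*` setT) r,
            (forall u, U (pi u) -> r (pi u, s u) = u),
            (forall y a, U y -> pi (r (y, a)) = y /\ s (r (y, a)) = a) &
            (forall u a, U (pi u) -> s (act u a) = (s u * a)%g)]].

Definition invariant_vf (act : P -> G -> P) (X : P -> EP) :=
  forall a u, mdiff (act ^~ a) u (X u) = X (act u a).
End PrincipalBundles.

Section Gamma.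
Context {R : realType} {E F F' EP EP' : normedModType R}.
Context {M : manifoldType E} {G : lieGroupType F} {Gam : lieGroupType F'}.
Context {P : manifoldType EP} {Pt : manifoldType EP'}.

(* the fourth clause says that the kernel is discrete *)
Definition central_hom (rho : Gam -> G) :=
  [/\ msmooth rho,
      forall a b, rho (a * b)%g = (rho a * rho b)%g,
      forall b, exists a, rho a = b,
      forall a, rho a = 1%g -> exists2 U : set Gam, open U &
        U `&` [set b | rho b = 1%g] = [set a] &
      forall a b, rho a = 1%g -> (a * b = b * a)%g].

Definition gamma_structure (rho : Gam -> G) (pit : Pt -> M) (actt : Pt -> Gam -> Pt)
    (pi : P -> M) (act : P -> G -> P) (zeta : Pt -> P) :=
  [/\ msmooth zeta, forall u, pi (zeta u) = pit u &
      forall u a, zeta (actt u a) = act (zeta u) (rho a)].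

(* T zeta o Xt = X o zeta *)
Definition projects (zeta : Pt -> P) (Xt : Pt -> EP') (X : P -> EP) :=
  forall u, mdiff zeta u (Xt u) = X (zeta u).
End Gamma.

Section Frames.
Context {R : realType} {m : nat} {M : manifoldType 'cV[R]_m}.

(* the right action of GL(m), u . A = u o A *)
Definition frame_act (u : frame M) (A : 'M[R]_m) : frame M :=
  mkframe (fbase u) (fmx u *m A).

(* L^1 phi : j^1_0 eps |-> j^1_0 (phi o eps) *)
Definition frame_lift (phi : M -> M) (u : frame M) : frame M :=
  mkframe (phi (fbase u)) (mapcols (mdiff phi (fbase u)) (fmx u)).

Definition natural_lift (X : M -> 'cV[R]_m) (u : frame M) : 'cV[R]_m * 'M[R]_m :=
  velocity (fun t => frame_lift (flow X t) u) 0.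

Definition expmx (A : 'M[R]_m) : 'M[R]_m :=
  limn (series (fun k => (k`!%:R)^-1 *: A ^+ k)).

(* the subspace M_u of T_u(LM) *)
Definition transversal (mm : {vspace 'M[R]_m}) (u : frame M) :
    set ('cV[R]_m * 'M[R]_m) :=
  [set velocity (fun t : R => frame_act u (expmx (t *: mu))) 0
    | mu in [set mu | mu \in mm]].
End Frames.

Section Subgroup.
Context {R : realType} {m k : nat} {G : lieGroupType 'cV[R]_k}.

(* G as a Lie subgroup of GL(m), given by its inclusion j: an injective immersive
   homomorphism; G need not have the topology induced by GL(m) *)
Definition lie_subgroup (j : G -> 'M[R]_m) :=
  [/\ msmooth j,
      forall a, j a \in unitmx,
      forall a b, j (a * b)%g = j a *m j b,
      injective j &
      forall a, injective (mdiff j a)].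

Definition lie_algebra (j : G -> 'M[R]_m) : {vspace 'M[R]_m} :=
  limg (linfun (mdiff j 1%g)).

Definition reductive (j : G -> 'M[R]_m) (mm : {vspace 'M[R]_m}) :=
  [/\ (lie_algebra j + mm)%VS = fullv,
      (lie_algebra j :&: mm)%VS = 0%VS &
      forall a mu, mu \in mm -> j a *m mu *m invmx (j a) \in mm].
End Subgroup.

Section Kosmann.
Context {R : realType} {m k p : nat} {M : manifoldType 'cV[R]_m}.
Context {G : lieGroupType 'cV[R]_k} {P : manifoldType 'cV[R]_p}.

(* P as a principal subbundle of LM, given by its inclusion i *)
Definition classical_G_structure (j : G -> 'M[R]_m) (mm : {vspace 'M[R]_m})
    (pi : P -> M) (act : P -> G -> P) (i : P -> frame M) :=
  [/\ lie_subgroup j /\ reductive j mm,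
      principal_bundle pi act,
      [/\ msmooth i, injective i & forall u, injective (mdiff i u)],
      forall u, fbase (i u) = pi u &
      forall u a, i (act u a) = frame_act (i u) (j a)].

(* the v in T_u P such that L X (i u) - T_u i (v) lies in M_(i u); it exists and is
   unique for a classical G-structure *)
Definition kosmann_lift (mm : {vspace 'M[R]_m}) (i : P -> frame M)
    (X : M -> 'cV[R]_m) (u : P) : 'cV[R]_p :=
  xget 0 [set v | exists2 w, transversal mm (i u) w &
                  natural_lift X (i u) = mdiff i u v + w].
End Kosmann.

(* Main.v *)
Require Import Defs.
From HB Require Import structures.
From mathcomp Require Import all_boot all_order all_algebra.
From mathcomp Require Import mathcomp_extra boolp classical_sets functions.
From mathcomp Require Import cardinality set_interval reals topology normedtype.
From mathcomp Require Import landau sequences derive prodnormedzmodule interval_inference.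
From mathcomp Require Import ring lra.
Set Implicit Arguments. Unset Strict Implicit. Unset Printing Implicit Defensive.
Import Order.TTheory GRing.Theory Num.Theory numFieldNormedType.Exports.
Local Open Scope classical_set_scope.
Local Open Scope ring_scope.

(* The lift exists and is unique because T zeta is bijective at every point; it is then smooth
   because it solves a linear system with smooth coefficients, and invariant because it is
   unique and xi_K is invariant.

   A vector of T Pt or T P that is vertical comes from the Lie algebra of the structure group,
   and zeta intertwines the two actions through rho, so T zeta is bijective as soon as
   T_1 rho is. If T_1 rho killed w <> 0, the powers b^N of an element b of Gam close to 1 in
   the direction w / N would stay in a compact set without kernel elements, while rho(b)^N
   tends to 1: this contradicts discreteness of the kernel. Since rho is onto, Baire's theorem
   gives a ball of R^k inside the Lipschitz image of a ball of R^n, so k <= n, and T_1 rho is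
   onto as well.

   In a frame chart, the natural lift of xi at (y, e) has the form (a y, B y e) with smooth a
   and B, and M_u = {(0, e mu) | mu in m}. Hence xi_K is again the solution of a linear system
   with smooth coefficients, and it is G-invariant since the natural lift and the splitting
   of T(LM) along P are. *)

(** * Smooth maps between finite-dimensional spaces *)

(** A surjective smooth homomorphism need not have a surjective derivative: the identity from the
    discrete group R onto the Lie group R, from dimension 0 to dimension 1, would be a central
    homomorphism. Second countability of the source excludes it, and [manifold_countable] is what
    lets Baire's theorem act. For injectivity of [T_1 rho] the usual argument runs along a
    one-parameter subgroup; powers [b^N] of small elements replace it here, controlled by strict
    differentiability of the multiplication. Smoothness of the lift usually comes from zeta being a
    local diffeomorphism. Here it comes from Cramer's rule: a pointwise solution of an injective
    system is a rational expression in the coefficients, hence as smooth as they are. The tangent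
    space at x is identified with the model space through [chart_at x], a choice with no regularity
    in x. Pointwise algebra is therefore done with [mdiff], while smoothness is tested after
    [tchange] to one fixed chart. *)

Class findim {R : realType} (F : normedModType R) : Prop :=
  findimP : exists (N : nat) (phi : 'I_N -> {linear F -> R^o}) (e : 'I_N -> F),
    (forall i, continuous (phi i)) /\ (forall v, v = \sum_i phi i v *: e i).

Section FinDim.
Context {R : realType}.

#[export] Instance findim_mx m n : findim 'M[R]_(m, n).
Proof.
exists #|{: 'I_m * 'I_n}|.
exists (fun l => coordl R (enum_val l).1 (enum_val l).2).
exists (fun l => delta_mx (enum_val l).1 (enum_val l).2).
split=> [l|v]; first exact: coord_continuous.
rewrite [LHS]matrix_sum_delta pair_big /=.
rewrite (reindex (@enum_val _ {: 'I_m * 'I_n})) //=.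
exact: (onW_bij _ (@enum_val_bij _)).
Qed.

#[export] Instance findim_R : findim R^o.
Proof.
exists 1%N, (fun=> idfun), (fun=> 1 : R^o); split=> [_ x|v]; first exact: cvg_id.
by rewrite big_ord1 /= /GRing.scale /= mulr1.
Qed.

#[export] Instance findim_prod (E F : normedModType R) :
  findim E -> findim F -> findim (E * F)%type.
Proof.
move=> [N [phi [e [cphi De]]]] [N' [psi [f [cpsi Df]]]].
exists (N + N')%N.
exists (fun i : 'I_(N + N') => match fintype.split i return {linear (E * F)%type -> R^o} with
  inl i => phi i \o fst | inr i => psi i \o snd end).
exists (fun i : 'I_(N + N') => match fintype.split i with
  inl i => (e i, 0) | inr i => (0, f i) end).
split=> [i|[v w]].
  case: splitP => j _ x.
    by apply: continuous_comp; [exact: cvg_fst|exact: cphi].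
  by apply: continuous_comp; [exact: cvg_snd|exact: cpsi].
rewrite big_split_ord /=; under eq_bigr do rewrite (unsplitK (inl _)).
under [in X in _ + X]eq_bigr do rewrite (unsplitK (inr _)).
rewrite /= {1}(De v) {1}(Df w).
have -> : \sum_i phi i v *: (e i, 0 : F) = (\sum_i phi i v *: e i, 0).
  elim/big_rec2: _ => // i x y _ ->.
  by rewrite -[LHS]/(phi i v *: e i + x, phi i v *: 0 + 0) scaler0 addr0.
have -> : \sum_i psi i w *: (0 : E, f i) = (0, \sum_i psi i w *: f i).
  elim/big_rec2: _ => // i x y _ ->.
  by rewrite -[LHS]/(psi i w *: 0 + 0, psi i w *: f i + x) scaler0 addr0.
by rewrite -[RHS]/(_ + 0, 0 + _) addr0 add0r.
Qed.

Lemma scalev_is_linear (F : normedModType R) (v : F) : linear (fun a : R^o => a *: v).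
Proof. by move=> a b c; rewrite scalerDl scalerA. Qed.

Definition scalev (F : normedModType R) (v : F) : {linear R^o -> F} :=
  HB.pack (fun a : R^o => a *: v) (GRing.isLinear.Build _ _ _ _ _ (scalev_is_linear v)).

Lemma findim_linear_continuous {E F : normedModType R} {fE : findim E}
  (L : {linear E -> F}) : continuous L.
Proof.
have [N [phi [e [cphi De]]]] := fE.
have -> : (L : E -> F) = fun v => \sum_i phi i v *: L (e i).
  by apply/funext => v; rewrite {1}(De v) linear_sum; apply: eq_bigr => i _; rewrite linearZ.
move=> x; apply: cvg_big => // [|i _]; first exact: add_continuous.
by apply: cvgZr_tmp; exact: cphi.
Qed.
End FinDim.

Section SmoothCalculus.
Context {R : realType}.
Implicit Types E F : normedModType R.

(** The set in [Ck] only selects the points at which iterated derivatives of a globally defined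
    function are tested, so [V] may change with the point. This permits a different target chart
    near each point of a chart domain. *)
Lemma Ck_local E F k (U : set E) (f : E -> F) :
  (forall x, U x -> exists2 V, V x & Ck k V f) -> Ck k U f.
Proof.
elim: k f => [|k IH] f H /=; first by move=> x /H[V Vx]; exact.
split=> [x /H[V Vx [+ _]]|v]; first exact.
by apply: IH => x /H[V Vx [_ /(_ v)]]; exists V.
Qed.

(** Coordinates of [F] reduce scaling to products of real functions, where [Ck_mul] applies. *)
Lemma Ck_scale E F k (U : set E) (f : E -> R) (g : E -> F) {fF : findim F} : open U ->
  Ck k U f -> Ck k U g -> Ck k U (fun x => f x *: g x).
Proof.
move=> oU cf cg; have [N [phi [e [cphi De]]]] := fF.
have -> : (fun x => f x *: g x) = fun x => \sum_i scalev (e i) (f x * phi i (g x)).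
  apply/funext => x; rewrite {1}(De (g x)) scaler_sumr.
  by apply: eq_bigr => i _; rewrite /= scalerA.
apply: Ck_sum => // i; apply: Ck_compl => //; first exact: findim_linear_continuous.
by apply: Ck_mul => //; apply: (Ck_compl oU (cphi i)).
Qed.

Lemma diff_coord E F (N : nat) (phi : 'I_N -> {linear E -> R^o}) (e : 'I_N -> E)
    (g : E -> F) x v : (forall v, v = \sum_i phi i v *: e i) ->
  'd g x v = \sum_i phi i v *: 'd g x (e i).
Proof.
by move=> De; rewrite {1}(De v) linear_sum; apply: eq_bigr => i _; rewrite linearZ.
Qed.

(** The chain rule differentiates [g] in the direction ['D_v f x], which moves with x, while [Ck]
    controls fixed directions. Expanding this direction in coordinates of [F] leaves a finite sum of
    fixed partial derivatives of [g], to which the induction applies. *)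
Lemma Ck_comp E F F' k (U : set E) (V : set F) (f : E -> F) (g : F -> F')
    {fF : findim F} {fF' : findim F'} : open U ->
  (forall x, U x -> V (f x)) -> Ck k U f -> Ck k V g -> Ck k U (fun x => g (f x)).
Proof.
move=> oU UV; elim: k g => [|k IH] g.
  by move=> cf cg x Ux; apply: continuous_comp; [exact: cf|exact/cg/UV].
move=> cf cg; have [df Df] := cf; have [dg Dg] := cg; split=> [x Ux|v].
  by apply: differentiable_comp; [exact: df|exact/dg/UV].
have [N [phi [e [cphi De]]]] := fF.
apply: (@Ck_ext _ _ _ _ _ (fun x => \sum_i phi i ('D_v f x) *: 'D_(e i) g (f x))) => //.
  move=> x Ux; have dfx := df x Ux; have dgx := dg _ (UV _ Ux).
  rewrite [RHS]deriveE; last exact: differentiable_comp.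
  rewrite (diff_comp dfx dgx) /= (diff_coord _ _ _ De) -(deriveE _ dfx).
  by apply: eq_bigr => i _; rewrite (deriveE _ dgx).
apply: Ck_sum => // i; apply: Ck_scale => //; first exact: (Ck_compl oU (cphi i) (Df v)).
exact: (IH _ (CkW cf) (Dg (e i))).
Qed.

Lemma Ck_inv E k (U : set E) (f : E -> R) : open U ->
  (forall x, U x -> f x != 0) -> Ck k U f -> Ck k U (fun x => (f x)^-1).
Proof.
move=> oU f0; elim: k f f0 => [|k IH] f f0.
  by move=> cf x Ux; apply: continuousV; [exact: f0|exact: cf].
move=> cf; have [df Df] := cf; split=> [x Ux|v].
  by apply: differentiableV; [exact: df|exact: f0].
have ci : Ck k U (fun x => (f x)^-1) by apply: IH => //; exact: CkW.
have := Ck_mul oU (Ck_mul oU (@Ck_cst _ _ _ k U (-1 : R)) (Ck_mul oU ci ci)) (Df v).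
apply: Ck_ext => // x Ux; rewrite deriveV ?f0//; last exact/diff_derivable/df.
by rewrite mulN1r -invfM -expr2 -[RHS]/(- _ * _) mulNr.
Qed.

Lemma Ck_prod E k (U : set E) (I : Type) (r : seq I) (f : I -> E -> R) : open U ->
  (forall i, Ck k U (f i)) -> Ck k U (fun x => \prod_(i <- r) f i x).
Proof.
move=> oU Cf; elim: r => [|i r IH].
  by under eq_fun do rewrite big_nil; exact: Ck_cst.
by under eq_fun do rewrite big_cons; exact: Ck_mul.
Qed.

Lemma Ck_entries E k (U : set E) m n (A : E -> 'M[R]_(m, n)) : open U ->
  (forall i j, Ck k U (fun x => A x i j : R)) <-> Ck k U A.
Proof.
move=> oU; split=> [H|H i j]; last first.
  by apply: (Ck_compl (L := coordl R i j)) H => //; exact: coord_continuous.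
have -> : A = fun x => \sum_i \sum_j scalev (delta_mx i j) (A x i j).
  by apply/funext => x; rewrite [LHS]matrix_sum_delta.
apply: Ck_sum => // i; apply: Ck_sum => // j.
by apply: Ck_compl => //; exact: findim_linear_continuous.
Qed.

Lemma Ck_det E k (U : set E) n (A : E -> 'M[R]_n) : open U ->
  Ck k U A -> Ck k U (fun x => \det (A x) : R).
Proof.
move=> oU /(Ck_entries _ _ oU) cA; apply: Ck_sum => // s; apply: Ck_mul => //.
  exact: Ck_cst.
exact: Ck_prod.
Qed.

Lemma Ck_mulmx E k (U : set E) m n p (A : E -> 'M[R]_(m, n)) (B : E -> 'M[R]_(n, p)) :
  open U -> Ck k U A -> Ck k U B -> Ck k U (fun x => A x *m B x).
Proof.
move=> oU /(Ck_entries _ _ oU) cA /(Ck_entries _ _ oU) cB.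
apply/(Ck_entries _ _ oU) => i j; under eq_fun do rewrite mxE.
by apply: Ck_sum => // l; apply: Ck_mul.
Qed.

Lemma Ck_trmx E k (U : set E) m n (A : E -> 'M[R]_(m, n)) :
  open U -> Ck k U A -> Ck k U (fun x => (A x)^T).
Proof.
move=> oU /(Ck_entries _ _ oU) cA.
by apply/(Ck_entries _ _ oU) => i j; under eq_fun do rewrite mxE.
Qed.

Lemma Ck_adj E k (U : set E) n (A : E -> 'M[R]_n) : open U ->
  Ck k U A -> Ck k U (fun x => \adj (A x)).
Proof.
move=> oU cA; apply/(Ck_entries _ _ oU) => i j.
under eq_fun do rewrite mxE /cofactor.
apply: Ck_mul => //; first exact: Ck_cst.
apply: Ck_det => //; move/(Ck_entries _ _ oU) in cA.
by apply/(Ck_entries _ _ oU) => a b; under eq_fun do rewrite !mxE.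
Qed.

(** Over the reals, [A^T A v = 0] makes the sum of squares of the entries of [A v] vanish. *)
Lemma unitmx_gram N q (A : 'M[R]_(N, q)) :
  (forall v : 'cV_q, A *m v = 0 -> v = 0) -> A^T *m A \in unitmx.
Proof.
move=> Ainj; rewrite -row_free_unit; apply: inj_row_free => v vA.
have : A *m v^T = 0.
  have : (A *m v^T)^T *m (A *m v^T) = 0.
    by rewrite trmx_mul trmxK -mulmxA [A^T *m _]mulmxA mulmxA vA mul0mx.
  move=> /matrixP/(_ 0 0); rewrite !mxE => /eqP.
  under eq_bigr do rewrite mxE -expr2.
  rewrite psumr_eq0 => [/allP z|i _]; last exact: sqr_ge0.
  apply/matrixP => i j; rewrite ord1 [RHS]mxE; apply/eqP.
  by rewrite -sqrf_eq0; apply: z; rewrite mem_index_enum.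
by move=> /Ainj /(congr1 trmx); rewrite trmxK trmx0.
Qed.

(* The solution of an overdetermined injective system is given by the normal
   equations A^T A x = A^T b and Cramer's rule. *)
Lemma Ck_solve E k (U : set E) N q (A : E -> 'M[R]_(N, q)) (b : E -> 'cV[R]_N)
    (x : E -> 'cV[R]_q) : open U -> Ck k U A -> Ck k U b ->
  (forall y, U y -> forall v : 'cV_q, A y *m v = 0 -> v = 0) ->
  (forall y, U y -> A y *m x y = b y) -> Ck k U x.
Proof.
move=> oU cA cb Ainj Ax.
pose S y := (A y)^T *m A y.
have cS : Ck k U S by apply: Ck_mulmx => //; exact: Ck_trmx.
have uS y : U y -> S y \in unitmx by move=> /Ainj; exact: unitmx_gram.
apply: (@Ck_ext _ _ _ _ _ (fun y => (\det (S y))^-1 *: (\adj (S y) *m ((A y)^T *m b y)))) => //.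
  move=> y Uy; rewrite -(Ax _ Uy) [X in _ *: (_ *m X)]mulmxA -/(S y).
  rewrite mulmxA mul_adj_mx mul_scalar_mx scalerA mulVf ?scale1r//.
  by rewrite -unitfE -unitmxE; exact: uS.
apply: Ck_scale => //.
  apply: Ck_inv => //; last exact: Ck_det.
  by move=> y Uy; rewrite -unitfE -unitmxE; exact: uS.
by apply: Ck_mulmx => //; [exact: Ck_adj|apply: Ck_mulmx => //; exact: Ck_trmx].
Qed.
End SmoothCalculus.

(** * Tangent maps in charts *)

Section Charts.
Context {R : realType} {E : normedModType R} {M : manifoldType E}.
Implicit Types (c : chart E M).

Lemma cinv_continuous_at c x : cdom c x -> {for cmap c x, continuous (cinv c)}.
Proof. by move=> cx; apply: cinv_continuous; exists x. Qed.

Lemma near_cinv c x (P : M -> Prop) : cdom c x ->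
  (\forall y \near x, P y) -> \forall y \near cmap c x, P (cinv c y).
Proof.
by move=> cx Px; apply: (cinv_continuous_at cx); rewrite /= cmapK.
Qed.

Lemma near_cmap c x (P : E -> Prop) : cdom c x ->
  (\forall y \near cmap c x, P y) -> \forall y \near x, P (cmap c y).
Proof. by move=> cx Px; apply: (cmap_continuous cx). Qed.

Lemma near_cdom c x : cdom c x -> \forall y \near x, cdom c y.
Proof. by move=> cx; apply: open_nbhs_nbhs; split=> //; exact: cdom_open. Qed.

Lemma near_cimg c x : cdom c x -> \forall y \near cmap c x, (cmap c @` cdom c) y.
Proof. by move=> cx; apply: open_near; [exact: cimg_open|exists x]. Qed.

Lemma cimgK c y : (cmap c @` cdom c) y -> cmap c (cinv c y) = y.
Proof. by move=> [x cx <-]; rewrite cmapK. Qed.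

Lemma cimg_dom c y : (cmap c @` cdom c) y -> cdom c (cinv c y).
Proof. by move=> [x cx <-]; rewrite cmapK. Qed.

End Charts.

Section ManifoldCalculus.
Context {R : realType} {E F : normedModType R}.
Context {M : manifoldType E} {N : manifoldType F}.
Implicit Types (c : chart E M) (d : chart F N) (f g : M -> N).

(** Continuity is a separate clause because [cmap] is arbitrary outside the chart domain:
    differentiability of the coordinate expression alone does not keep nearby values of [f] in that
    domain. *)
Definition mderivable f x := {for x, continuous f} /\
  differentiable (cmap (chart_at (f x) : chart F N) \o f \o cinv (chart_at x : chart E M))
    (cmap (chart_at x : chart E M) x).

Lemma mdiffD f x u v : mdiff f x (u + v) = mdiff f x u + mdiff f x v.
Proof. by rewrite /mdiff linearD. Qed.

Lemma mdiffB f x u v : mdiff f x (u - v) = mdiff f x u - mdiff f x v.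
Proof. by rewrite /mdiff linearB. Qed.

Lemma mdiff0 f x : mdiff f x 0 = 0.
Proof. by rewrite /mdiff linear0. Qed.

Lemma mdiff_near_eq f g x : (\forall y \near x, f y = g y) -> mderivable f x ->
  mderivable g x /\ mdiff g x = mdiff f x.
Proof.
move=> fg [cf df].
have gf : f x = g x by exact: (nbhs_singleton fg).
have H : \forall y \near cmap (chart_at x : chart E M) x,
    (cmap (chart_at (f x)) \o f \o cinv (chart_at x)) y =
    (cmap (chart_at (g x)) \o g \o cinv (chart_at x)) y.
  apply: filterS (near_cinv (chart_at_dom x) fg) => y /= ->.
  by rewrite gf.
have [dg e] := near_eq_differentiable H df; split; last exact: e.
split; last exact: dg.
change (g @ x --> g x); rewrite -gf; apply: cvg_trans cf; exact: near_eq_cvg.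
Qed.

(** Near the point, the expression of [f] in [c] and [d] is the one in the chosen charts composed
    with two transition maps; continuity of [f] keeps nearby values in the domain of the chosen
    target chart. *)
Lemma mderivable_chart f x c d : mderivable f x -> atlas c -> atlas d ->
  cdom c x -> cdom d (f x) ->
  differentiable (cmap d \o f \o cinv c) (cmap c x) /\
  forall v, 'd (cmap d \o f \o cinv c) (cmap c x) (tchange (chart_at x) c x v) =
    tchange (chart_at (f x)) d (f x) (mdiff f x v).
Proof.
move=> [cf df] ac ad cx dfx.
pose c' : chart E M := chart_at x; pose d' : chart F N := chart_at (f x).
have c'x : cdom c' x by exact: chart_at_dom.
have d'x : cdom d' (f x) by exact: chart_at_dom.
have ac' : atlas c' by exact: chart_at_atlas.
have ad' : atlas d' by exact: chart_at_atlas.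
have d1 := transition_differentiable ac ac' cx c'x.
have d3 := transition_differentiable ad' ad d'x dfx.
have d2 : differentiable (cmap d' \o f \o cinv c') ((cmap c' \o cinv c) (cmap c x)).
  by rewrite /= cmapK.
have d12 := differentiable_comp d1 d2.
have d3' : differentiable (cmap d \o cinv d')
    (((cmap d' \o f \o cinv c') \o (cmap c' \o cinv c)) (cmap c x)).
  by rewrite /= cmapK// cmapK.
have H : \forall y \near cmap c x, ((cmap d \o cinv d') \o
    ((cmap d' \o f \o cinv c') \o (cmap c' \o cinv c))) y = (cmap d \o f \o cinv c) y.
  have nd : \forall y \near x, cdom d' (f y) by apply: cf; exact: near_cdom.
  apply: filterS2 (near_cinv cx nd) (near_cinv cx (near_cdom c'x)) => y /= ? ?.
  by rewrite !cmapK.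
have [D e] := near_eq_differentiable H (differentiable_comp d12 d3').
split=> [|v]; first exact: D.
have e2 := diff_comp d12 d3'; have e3 := diff_comp d1 d2.
rewrite e e2 [X in X _ = _]/= e3 /= cmapK// cmapK//.
have tK : 'd (cmap c' \o cinv c) (cmap c x) (tchange (chart_at x) c x v) = v.
  exact: (tchangeK ac' ac c'x cx v).
by rewrite tK.
Qed.

(** The passage from arbitrary charts back to the chosen ones. Continuity of [f] is recovered by
    writing it locally as [cinv d] after the differentiable coordinate expression after [cmap c]. *)
Lemma mderivable_local f x c d : atlas c -> atlas d -> cdom c x ->
  (\forall y \near x, cdom d (f y)) -> differentiable (cmap d \o f \o cinv c) (cmap c x) ->
  mderivable f x.
Proof.
move=> ac ad cx ndf df; have dfx := nbhs_singleton ndf.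
pose c' : chart E M := chart_at x; pose d' : chart F N := chart_at (f x).
have c'x : cdom c' x by exact: chart_at_dom.
have d'x : cdom d' (f x) by exact: chart_at_dom.
have ac' : atlas c' by exact: chart_at_atlas.
have ad' : atlas d' by exact: chart_at_atlas.
have cf : {for x, continuous f}.
  have H : \forall y \near x, (cinv d \o ((cmap d \o f \o cinv c) \o cmap c)) y = f y.
    by apply: filterS2 (near_cdom cx) ndf => y cy dfy /=; rewrite !cmapK.
  change (f @ x --> f x); rewrite -(nbhs_singleton H); apply: cvg_trans; first exact: near_eq_cvg H.
  apply: continuous_comp.
    apply: continuous_comp; first exact: cmap_continuous.
    exact: differentiable_continuous.
  by rewrite /= cmapK//; exact: cinv_continuous_at.
split=> //.
have d1 := transition_differentiable ac' ac c'x cx.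
have d3 := transition_differentiable ad ad' dfx d'x.
have d2 : differentiable (cmap d \o f \o cinv c) ((cmap c \o cinv c') (cmap c' x)).
  by rewrite /= cmapK.
have d12 := differentiable_comp d1 d2.
have d3' : differentiable (cmap d' \o cinv d)
    (((cmap d \o f \o cinv c) \o (cmap c \o cinv c')) (cmap c' x)).
  by rewrite /= cmapK// cmapK.
apply: (near_eq_differentiable _ (differentiable_comp d12 d3')).1.
apply: filterS2 (near_cinv c'x ndf) (near_cinv c'x (near_cdom cx)) => y /= ? ?.
by rewrite !cmapK.
Qed.

Lemma msmooth_at_mderivable f x : msmooth_at f x -> mderivable f x.
Proof.
move=> [W [oW Wx Wc Wd sW]].
apply: (mderivable_local (c := chart_at x) (d := chart_at (f x)));
  [exact: chart_at_atlas|exact: chart_at_atlas|exact: chart_at_dom| |].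
  have := near_cmap (chart_at_dom x) (open_near oW Wx).
  apply: filterS2 (near_cdom (chart_at_dom x)) => y cy Wy.
  by have := Wd _ Wy; rewrite cmapK.
exact: (sW 1%N).1.
Qed.
End ManifoldCalculus.

Section ManifoldComp.
Context {R : realType} {E F F' : normedModType R}.
Context {M : manifoldType E} {N : manifoldType F} {L : manifoldType F'}.
Implicit Types (f : M -> N) (g : N -> L).

Lemma mdiff_comp f g x : mderivable f x -> mderivable g (f x) ->
  mderivable (g \o f) x /\ forall v, mdiff (g \o f) x v = mdiff g (f x) (mdiff f x v).
Proof.
move=> [cf df] [cg dg].
have cxK : cinv (chart_at x : chart E M) (cmap (chart_at x : chart E M) x) = x.
  by rewrite cmapK//; exact: chart_at_dom.
have dg' : differentiable (cmap (chart_at (g (f x)) : chart F' L) \o g \o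
    cinv (chart_at (f x) : chart F N))
    ((cmap (chart_at (f x) : chart F N) \o f \o cinv (chart_at x : chart E M))
      (cmap (chart_at x : chart E M) x)).
  by rewrite /= cxK.
have H : \forall y \near cmap (chart_at x : chart E M) x,
   ((cmap (chart_at (g (f x)) : chart F' L) \o g \o cinv (chart_at (f x) : chart F N)) \o
   (cmap (chart_at (f x) : chart F N) \o f \o cinv (chart_at x : chart E M))) y =
   (cmap (chart_at (g (f x))) \o (g \o f) \o cinv (chart_at x)) y.
  have nd : \forall y \near x, cdom (chart_at (f x) : chart F N) (f y).
    by apply: cf; apply: near_cdom; exact: chart_at_dom.
  by apply: filterS (near_cinv (chart_at_dom x) nd) => y dy /=; rewrite cmapK.
have [D e] := near_eq_differentiable H (differentiable_comp df dg').
split=> [|v]; last first.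
  have e2 := diff_comp df dg'; rewrite /mdiff e e2 /=.
  by rewrite cxK.
split; last exact: D.
by apply: continuous_comp.
Qed.

Lemma mdiff_cst (b : N) (x : M) : mderivable (fun=> b) x /\ mdiff (fun=> b) x = fun=> 0.
Proof.
split.
  split; first exact: cst_continuous.
  exact: differentiable_cst.
apply/funext => v; exact: (congr1 (@^~ v) (diff_cst _ _)).
Qed.

Lemma mdiff_id (x : M) : mderivable id x /\ mdiff id x = id.
Proof.
have e : mdiff (@id M) x = id := tchange_id (chart_at_dom x).
split=> //; split; first by move=> A.
exact: (transition_differentiable (chart_at_atlas x) (chart_at_atlas x)
   (chart_at_dom x) (chart_at_dom x)).
Qed.

Lemma mdiff_pair f (h : M -> L) x : mderivable f x -> mderivable h x ->
  mderivable (fun y => (f y, h y)) x /\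
  forall v, mdiff (fun y => (f y, h y)) x v = (mdiff f x v, mdiff h x v).
Proof.
move=> [cf df] [ch dh]; split=> [|v].
  split; first by apply: cvg_pair.
  exact: differentiable_pair df dh.
exact: (congr1 (@^~ v) (diff_pair df dh)).
Qed.
End ManifoldComp.

Lemma open_preimage_in (T U : topologicalType) (A : set T) (f : T -> U) (B : set U) :
  open A -> (forall x, A x -> {for x, continuous f}) -> open B -> open (A `&` f @^-1` B).
Proof.
move=> oA cf oB; rewrite openE => x [Ax Bx]; apply: filterI.
  exact: open_nbhs_nbhs.
by apply: (cf x Ax); exact: open_nbhs_nbhs.
Qed.

Section SmoothCharts.
Context {R : realType} {E F : normedModType R} {fE : findim E} {fF : findim F}.
Context {M : manifoldType E} {N : manifoldType F}.

Lemma msmooth_at_chart (f : M -> N) x (c : chart E M) (d : chart F N) :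
  msmooth_at f x -> atlas c -> atlas d -> cdom c x -> cdom d (f x) ->
  exists W : set E, [/\ open W, W (cmap c x), W `<=` cmap c @` cdom c,
    (forall y, W y -> cdom d (f (cinv c y))) & smooth_on W (cmap d \o f \o cinv c)].
Proof.
pose c' : chart E M := chart_at x; pose d' : chart F N := chart_at (f x).
move=> [W0 []]; rewrite -/c' -/d' => oW0 W0x W0c W0d s0 ac ad cx dfx.
have c'x : cdom c' x by exact: chart_at_dom.
have d'x : cdom d' (f x) by exact: chart_at_dom.
have ac' : atlas c' by exact: chart_at_atlas.
have ad' : atlas d' by exact: chart_at_atlas.
(* [W1] keeps the points of [W0] whose values also lie in the domain of [d]; it is open because the
   coordinate expression is continuous on [W0]. [W] below transports it to the chart [c]. *)
pose W1 := W0 `&` (cmap d' \o f \o cinv c') @^-1` (cmap d' @` (cdom d' `&` cdom d)).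
have oW1 : open W1 by apply: open_preimage_in => //; [exact: (s0 0)|exact: overlap_open].
pose V := cmap c @` (cdom c `&` cdom c').
have oV : open V by exact: overlap_open.
pose W := V `&` (cmap c' \o cinv c) @^-1` W1.
have sV := atlas_smooth _ _ ac ac'.
have oW : open W by apply: open_preimage_in => //; exact: (sV 0).
have WE y : W y -> exists z, [/\ y = cmap c z, cdom c z, cdom c' z, cdom d' (f z) & cdom d (f z)].
  move=> [[z [cz c'z] <-] [+ [w [d'w dw]]]]; rewrite /= cmapK// cmapK// => W0z e.
  have d'z : cdom d' (f z) by have := W0d _ W0z; rewrite cmapK.
  exists z; split=> //.
  by have := congr1 (cinv d') e; rewrite !cmapK// => <-.
exists W; split=> //.
- split; first by exists x.
  rewrite /= cmapK//; split=> //=; rewrite cmapK//; by exists (f x).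
- by move=> y /WE[z [-> cz _ _ _]]; exists z.
- by move=> y /WE[z [-> cz _ _ dz]]; rewrite cmapK.
move=> k.
apply: (@Ck_ext _ _ _ _ _ (fun y => (cmap d \o cinv d')
    ((cmap d' \o f \o cinv c') ((cmap c' \o cinv c) y)))) => //.
  by move=> y /WE[z [-> cz c'z d'z dz]]; rewrite /= cmapK// cmapK// cmapK.
apply: (Ck_comp (V := cmap d' @` (cdom d' `&` cdom d))) => //.
- by move=> y [_ [_ ]].
- apply: (Ck_comp (V := W0)) => //.
  + by move=> y [_ []].
  + by apply: Ck_subset (sV k) => y [].
- exact: atlas_smooth.
Qed.

Lemma vf_in_chartE (c : chart E M) (X : M -> E) x : cdom c x ->
  vf_in_chart c X (cmap c x) = tchange (chart_at x) c x (X x).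
Proof. by move=> cx; rewrite /vf_in_chart cmapK. Qed.
End SmoothCharts.

Section Velocity.
Context {R : realType} {E : normedModType R} {M : manifoldType E}.

Lemma velocity_chart (gamma : R -> M) t (c : chart E M) : atlas c ->
  (\forall s \near t, cdom c (gamma s)) -> differentiable (cmap c \o gamma) t ->
  tchange (chart_at (gamma t)) c (gamma t) (velocity gamma t) = derive1 (cmap c \o gamma) t.
Proof.
move=> ac nc dc; have ct := nbhs_singleton nc.
pose c' : chart E M := chart_at (gamma t).
have c't : cdom c' (gamma t) by exact: chart_at_dom.
have ac' : atlas c' by exact: chart_at_atlas.
have dt : differentiable (cmap c' \o cinv c) ((cmap c \o gamma) t).
  exact: (transition_differentiable ac ac' ct c't).
have H : \forall s \near t, ((cmap c' \o cinv c) \o (cmap c \o gamma)) s = (cmap c' \o gamma) s.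
  by apply: filterS nc => s cs /=; rewrite cmapK.
have [D e] := near_eq_differentiable H (differentiable_comp dc dt).
have -> : velocity gamma t = 'd (cmap c' \o gamma) t 1 by exact: derive1E'.
have -> : derive1 (cmap c \o gamma) t = 'd (cmap c \o gamma) t 1 by exact: derive1E'.
have -> : 'd (cmap c' \o gamma) t 1 = tchange c c' (gamma t) ('d (cmap c \o gamma) t 1).
  exact: etrans (congr1 (@^~ 1) e) (congr1 (@^~ 1) (diff_comp dc dt)).
exact: (tchangeK ac ac' ct c't).
Qed.
End Velocity.

(** * Tangent spaces of principal bundles *)

Section Partial.
Context {R : realType} {E F F' : normedModType R}.
Context {M : manifoldType E} {N : manifoldType F} {L : manifoldType F'}.

Lemma mdiff_partial_r (f : M * N -> L) x y : mderivable f (x, y) ->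
  mderivable (fun b => f (x, b)) y /\
  forall w, mdiff (fun b => f (x, b)) y w = mdiff f (x, y) (0, w).
Proof.
move=> df; have [dc ec] := mdiff_cst x y; have [di ei] := mdiff_id y.
have [dp ep] := mdiff_pair dc di; have [D e] := mdiff_comp dp df.
by split=> [|w]; [exact: D|apply: etrans (e w) _; rewrite ep ec ei].
Qed.

Lemma mdiff_partial_l (f : M * N -> L) x y : mderivable f (x, y) ->
  mderivable (fun a => f (a, y)) x /\
  forall v, mdiff (fun a => f (a, y)) x v = mdiff f (x, y) (v, 0).
Proof.
move=> df; have [dc ec] := mdiff_cst y x; have [di ei] := mdiff_id x.
have [dp ep] := mdiff_pair di dc; have [D e] := mdiff_comp dp df.
by split=> [|w]; [exact: D|apply: etrans (e w) _; rewrite ep ec ei].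
Qed.
End Partial.

Section LieTranslation.
Context {R : realType} {F : normedModType R} {G : lieGroupType F}.

Lemma mderivable_mulg (a b : G) : mderivable (fun x => a * x)%g b.
Proof.
by have [] := mdiff_partial_r (msmooth_at_mderivable (lie_mul_smooth (a, b))).
Qed.

Lemma mdiff_mulg_inj (a b : G) : injective (mdiff (fun x => a * x)%g b).
Proof.
move=> v w vw.
have [D e] := mdiff_comp (mderivable_mulg a b) (mderivable_mulg a^-1%g (a * b)%g).
have id_ : (fun x => a^-1 * x)%g \o (fun x => a * x)%g = @id G.
  by apply/funext => x; exact: mulKg.
have [_ ei] := mdiff_id b.
by have := e v; rewrite vw -e id_ ei.
Qed.
End LieTranslation.

Section BundleTangent.
Context {R : realType} {E F EP : normedModType R}.
Context {M : manifoldType E} {G : lieGroupType F} {P : manifoldType EP}.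
Context (pi : P -> M) (act : P -> G -> P) (B : principal_bundle pi act).

Lemma bundle_proj_mderivable u : mderivable pi u.
Proof. by have [/(_ u)/msmooth_at_mderivable] := B. Qed.

Lemma bundle_act_mderivable u a : mderivable (fun z : P * G => act z.1 z.2) (u, a).
Proof. by have [_ /(_ (u, a))/msmooth_at_mderivable] := B. Qed.

Lemma bundle_orbit_mderivable u a : mderivable (act u) a.
Proof. exact: (mdiff_partial_r (bundle_act_mderivable u a)).1. Qed.

Lemma bundle_translation_mderivable a u : mderivable (act ^~ a) u.
Proof. exact: (mdiff_partial_l (bundle_act_mderivable u a)).1. Qed.

(** In a local trivialization [s \o act u] is left translation by [s u], whose tangent map is
    injective. *)
Lemma mdiff_orbit_inj u : injective (mdiff (act u) 1%g).
Proof.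
have [_ _ [act1 _] piact /(_ (pi u))[U [s [r [[_ Uu] [ds _] _ _ sact]]]]] := B.
have dsu : mderivable s (act u 1%g).
  by rewrite act1; apply: msmooth_at_mderivable; exact: ds.
have [_ e] := mdiff_comp (bundle_orbit_mderivable u 1%g) dsu.
move=> v w vw; have := e v; rewrite vw -e.
rewrite (_ : s \o act u = fun a => (s u * a)%g); last first.
  by apply/funext => a /=; exact: sact.
by move/esym/mdiff_mulg_inj.
Qed.

(** The map [r (_, s u)] is a local section of [pi] through [u]. *)
Lemma mdiff_proj_surj u w : exists v, mdiff pi u v = w.
Proof.
have [_ _ _ _ /(_ (pi u))[U [s [r [[oU Uu] [_ dr] rK Kr _]]]]] := B.
have dru : mderivable r (pi u, s u).
  by apply: msmooth_at_mderivable; exact: dr.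
have [D e] := mdiff_partial_l dru.
have dpi : mderivable pi (r (pi u, s u)) by exact: bundle_proj_mderivable.
have [D2 e2] := mdiff_comp D dpi.
have H : \forall y \near pi u, (pi \o (fun y => r (y, s u))) y = id y.
  have : \forall y \near pi u, U y by exact: open_nbhs_nbhs.
  by apply: filterS => y Uy /=; exact: (Kr _ _ Uy).1.
have [_ e3] := mdiff_near_eq H D2.
exists (mdiff (fun y => r (y, s u)) (pi u) w).
by have := e2 w; rewrite rK// -e3 (mdiff_id _).2.
Qed.

(** Differentiating [r (pi y, s y) = y] at [u] writes a vertical [v] as the image of [T s v] under
    the tangent map of [r (pi u, _)], and this map is [act u] after left translation by the inverse
    of [s u]. *)
Lemma mdiff_vertical u v : mdiff pi u v = 0 -> exists tau, v = mdiff (act u) 1%g tau.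
Proof.
have [_ _ [act1 actM] piact /(_ (pi u))[U [s [r [[oU Uu] [ds dr] rK Kr sact]]]]] := B.
move=> v0.
have dru : mderivable r (pi u, s u).
  by apply: msmooth_at_mderivable; exact: dr.
have dsu : mderivable s u by apply: msmooth_at_mderivable; exact: ds.
have [dp ep] := mdiff_pair (bundle_proj_mderivable u) dsu.
have [D e] := mdiff_comp dp dru.
have H : \forall y \near u, (r \o (fun y => (pi y, s y))) y = id y.
  have : \forall y \near u, U (pi y).
    by apply: (bundle_proj_mderivable u).1; exact: open_nbhs_nbhs.
  by apply: filterS => y Uy /=; exact: rK.
have [_ e2] := mdiff_near_eq H D.
have [_ e3] := mdiff_partial_r dru.
have orb : (fun a => r (pi u, a)) = act u \o (fun a => (s u)^-1 * a)%g.
  apply/funext => a /=; have := rK (act u ((s u)^-1 * a)%g).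
  by rewrite piact sact// mulVKg; apply.
have dl := mderivable_mulg (s u)^-1%g (s u).
have dorb : mderivable (act u) ((s u)^-1 * s u)%g by exact: bundle_orbit_mderivable.
have [_ e4] := mdiff_comp dl dorb.
exists (mdiff (fun a => ((s u)^-1 * a)%g) (s u) (mdiff s u v)).
have := e v; rewrite -e2 (mdiff_id _).2 ep v0 -e3 orb e4.
by rewrite mulVg.
Qed.
End BundleTangent.

(** * The derivative of a central homomorphism at 1 *)

Section StrictDifferentiability.
Context {R : realType}.

(** Continuity of the differential in operator norm, drawn from continuity of the finitely many
    partial derivatives along [e i]; the Lipschitz constants [k i] of the coordinates bound their
    contributions. *)
Lemma C1_diff_small (E : normedModType R) {fE : findim E} (U : set E) (h : E -> R) x0 :
  open U -> U x0 -> Ck 1 U h -> (forall v, 'd h x0 v = 0) -> forall eps, 0 < eps ->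
  \forall z \near x0, U z /\ forall w, `|'d h z w| <= eps * `|w|.
Proof.
move=> oU Ux [dh Dh] h0 eps eps0; have [N [phi [e [cphi De]]]] := fE.
have K_ i := linear_lipschitz (cphi i).
pose k i := projT1 (cid2 (K_ i)).
have k0 i : 0 < k i by rewrite /k; case: cid2.
have kP i w : `|phi i w| <= k i * `|w| by rewrite /k; case: cid2.
(* The summand 1 keeps the divisor positive even when there are no coordinates. *)
pose S := 1 + \sum_i k i.
have S0 : 0 < S by rewrite ltr_pwDl// sumr_ge0// => i _; exact: ltW.
have : \forall z \near x0, forall i, `|'D_(e i) h z| < eps / S.
  apply: filter_forall => i.
  have c0 : (fun x => 'D_(e i) h x) x @[x --> x0] --> (0 : R).
    rewrite -[X in _ --> X](h0 (e i)) -(deriveE _ (dh _ Ux)).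
    exact: (Dh (e i) x0 Ux).
  have /cvgrPdist_lt/(_ (eps / S)) := c0; rewrite divr_gt0// => /(_ isT).
  by apply: filterS => z; rewrite sub0r normrN.
apply: filterS2 (open_near oU Ux) => z Uz H; split=> // w.
rewrite (diff_coord _ _ _ De); apply: le_trans (ler_norm_sum _ _ _) _.
apply: (@le_trans _ _ (\sum_i (k i * `|w| * (eps / S)))).
  apply: ler_sum => i _; rewrite normrZ ler_pM// -deriveE; last exact: dh.
  exact/ltW.
rewrite -!mulr_suml mulrAC ler_wpM2r// mulrA ler_pdivrMr// mulrC ler_pM2l//.
by rewrite /S lerDr.
Qed.

(** Mean value theorem on the segment from [y] to [x], which stays in a ball where the differential
    is small. *)
Lemma C1_scalar_strict (E : normedModType R) {fE : findim E} (U : set E) (h : E -> R) x0 :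
  open U -> U x0 -> Ck 1 U h -> (forall v, 'd h x0 v = 0) -> forall eps, 0 < eps ->
  \forall d \near 0^'+, forall x y, `|x - x0| < d -> `|y - x0| < d ->
    `|h x - h y| <= eps * `|x - y|.
Proof.
move=> oU Ux Ch h0 eps eps0.
have [r /= r0 Hr] : nbhs_ball x0 (fun z => U z /\ forall w, `|'d h z w| <= eps * `|w|).
  by apply/nbhs_ballP; exact: C1_diff_small.
near=> d => x y xd yd.
have dr : d <= r by near: d; exact: nbhs_right_le.
pose p (t : R) := y + t *: (x - y).
have pr (t : R) : 0 <= t <= 1 -> U (p t) /\ forall w, `|'d h (p t) w| <= eps * `|w|.
  move=> /andP[t0 t1]; apply: Hr; rewrite -ball_normE /ball_ /= distrC.
  have -> : p t - x0 = (1 - t) *: (y - x0) + t *: (x - x0).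
    rewrite /p scalerBl scale1r -[RHS]addrA -scalerN -scalerDr opprB.
    by rewrite [x0 - y + _]addrC addrA subrK [RHS]addrAC.
  apply: lt_le_trans dr; apply: le_lt_trans (ler_normD _ _) _.
  rewrite !normrZ (ger0_norm t0) ger0_norm ?subr_ge0//.
  (* The strict inequality is taken from the term with factor [t], so [t = 0] is treated apart. *)
  move: t0; rewrite le_eqVlt => /predU1P[<-|t0].
    by rewrite subr0 mul1r mul0r addr0.
  have : (1 - t) * `|y - x0| + t * `|x - x0| < (1 - t) * d + t * d.
    by rewrite ler_ltD// ?ltr_pM2l// ler_wpM2l ?subr_ge0// ltW.
  by rewrite -mulrDl subrK mul1r.
have dp (t : R) : is_diff t p (fun s => s *: (x - y)).
  by apply: is_diff_eq; rewrite add0r.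
pose g := h \o p.
have dg (t : R) : 0 <= t <= 1 -> is_derive t (1 : R) g ('d h (p t) (x - y)).
  move=> /pr[Upt _].
  have dhp : differentiable h (p t) by exact: (Ch.1 _ Upt).
  have dpt : differentiable p t by [].
  have dgt : differentiable g t by exact: differentiable_comp.
  apply: DeriveDef; first exact: diff_derivable.
  rewrite deriveE// /g (diff_comp dpt dhp) /= [in LHS]diff_val.
  by rewrite scale1r.
have [] := @MVT_segment R g (fun t => 'd h (p t) (x - y)) 0 1 ler01.
- by move=> t; rewrite in_itv /= => /andP[/ltW ? /ltW ?]; apply: dg; apply/andP.
- apply: derivable_within_continuous => t; rewrite in_itv /= => t01.
  by have [] := dg t t01.
move=> t; rewrite in_itv /= => t01.
rewrite /g /p /= scale1r scale0r addr0 [y + _]addrC subrK subr0 mulr1 => ->.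
exact: (pr t t01).2.
Unshelve. all: by end_near. Qed.

(** Both points move, which differentiability at [x0] alone does not allow. The mean value theorem
    is for real values, so it is applied to the coordinates of [f] minus its linear part, whose
    differential vanishes at [x0]. *)
Lemma C1_strict (E F : normedModType R) {fE : findim E} {fF : findim F}
    (U : set E) (f : E -> F) x0 :
  open U -> U x0 -> Ck 1 U f -> forall eps, 0 < eps ->
  \forall d \near 0^'+, forall x y, `|x - x0| < d -> `|y - x0| < d ->
    `|f x - f y - 'd f x0 (x - y)| <= eps * `|x - y|.
Proof.
move=> oU Ux Cf eps eps0; have [N [phi [e [cphi De]]]] := fF.
pose S := 1 + \sum_i `|e i|.
have S0 : 0 < S by rewrite ltr_pwDl// sumr_ge0.
have df : differentiable f x0 by exact: Cf.1.
pose L : {linear E -> F} := 'd f x0.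
have cL : continuous L by exact: diff_continuous.
have dL : differentiable L x0 by exact: linear_differentiable.
pose h i x := phi i (f x - L x).
have Ch i : Ck 1 U (h i).
  apply: (Ck_compl oU (cphi i)); apply: Ck_add => //.
  apply: (Ck_compl (L := -%R)) => //; first exact: findim_linear_continuous.
  exact: Ck_lin.
have h0 i v : 'd (h i) x0 v = 0.
  have dD : differentiable (f - (L : E -> F)) x0 by exact: differentiableB.
  have dphi : differentiable (phi i) ((f - (L : E -> F)) x0).
    exact: linear_differentiable.
  apply: etrans (congr1 (@^~ v) (diff_comp dD dphi)) _.
  rewrite /= (diff_lin _ (cphi i)).
  have -> : 'd (f - (L : E -> F)) x0 v = 0; last by rewrite linear0.
  by rewrite diffB// (diff_lin _ cL); exact: subrr.
have : \forall d \near (0 : R)^'+, forall i x y, `|x - x0| < d -> `|y - x0| < d ->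
    `|h i x - h i y| <= eps / S * `|x - y|.
  by apply: filter_forall => i; apply: (C1_scalar_strict oU Ux (Ch i) (h0 i)); rewrite divr_gt0.
apply: filterS => d H x y xd yd.
rewrite (De (f x - f y - 'd f x0 (x - y))); apply: le_trans (ler_norm_sum _ _ _) _.
apply: (@le_trans _ _ (\sum_i ((eps / S * `|x - y|) * `|e i|))).
  apply: ler_sum => i _; rewrite normrZ ler_wpM2r//.
  apply: le_trans (H i x y xd yd); rewrite /h -linearB/=.
  by rewrite -/L [L (x - y)]linearB /= !opprB [in leRHS]addrACA [- L x - _]addrC addrACA.
rewrite -mulr_sumr mulrAC ler_wpM2r//.
by rewrite mulrAC ler_pdivrMr// ler_pM2l// /S lerDr.
Qed.

(** Heine-Borel for row vectors, carried over by the isometry [mxvec] and a translation. *)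
Lemma mx_closed_ball_compact m n (a : 'M[R]_(m, n)) r :
  compact [set x | `|x - a| <= r].
Proof.
have c1 : compact [set v : 'rV[R]_(m * n) | `|v| <= r].
  apply: bounded_closed_compact.
    exists r; split=> [|s rs v /= /le_trans]; first exact: num_real.
    by apply; exact: ltW.
  apply: (@closed_comp _ _ (fun v : 'rV[R]_(m * n) => `|v|) [set x | x <= r]).
    by move=> v _; exact: norm_continuous.
  exact: closed_le.
have -> : [set x | `|x - a| <= r] = (fun v => vec_mx v + a) @` [set v : 'rV[R]_(m * n) | `|v| <= r].
  have nE (x : 'M[R]_(m, n)) : `|mxvec x| <= r <-> `|x| <= r.
    rewrite /Num.norm /= !mx_normrE.
    split=> /bigmax_leP[r0 H]; apply/bigmax_leP; split=> // -[i j] _ /=.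
      by have := H (0, mxvec_index i j) isT; rewrite /= mxvecE.
    by case/mxvec_indexP: j => j l; have := H (j, l) isT; rewrite /= ord1 mxvecE.
  apply/seteqP; split=> [x /= xr|_ [v /= vr <-]].
    by exists (mxvec (x - a)); [exact/nE|rewrite mxvecK subrK].
  by rewrite addrK; apply/nE; rewrite vec_mxK.
apply: continuous_compact c1; apply: continuous_subspaceT => v.
pose L : {linear 'rV[R]_(m * n) -> 'M[R]_(m, n)} := vec_mx.
have cL := Ck_lin 0 setT (@findim_linear_continuous _ _ _ (findim_mx _ _) L).
have H := Ck_add openT cL (Ck_cst 0 setT a).
exact: (H v I).
Qed.
End StrictDifferentiability.

(** * Multiplication and powers near the identity of a Lie group *)

Section LieNear.
Context {R : realType} {F : normedModType R} {fF : findim F} {G : lieGroupType F}.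
Let c : chart F G := chart_at 1%g.
Let c0 := cmap c 1%g.

(** Since [1 * b = b], the differential of the multiplication at the identity is the identity in the
    second variable; strict differentiability makes this uniform in [a]. *)
Lemma lie_mul_near eps : 0 < eps -> \forall d \near (0 : R)^'+, forall a b : G,
  cdom c a -> cdom c b -> `|cmap c a - c0| < d -> `|cmap c b - c0| < d ->
  cdom c (a * b)%g /\
  `|cmap c (a * b)%g - cmap c a - (cmap c b - c0)| <= eps * `|cmap c b - c0|.
Proof.
move=> eps0; have c1 : cdom c 1%g by exact: chart_at_dom.
have ac : atlas c by exact: chart_at_atlas.
have cc1 : cdom (prod_chart c c) (1%g, 1%g) by split.
have acc : @atlas _ _ (G * G)%type (prod_chart c c) by exists (c, c).
pose mul (z : G * G) := (z.1 * z.2)%g.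
have c11 : cdom c (mul (1, 1)%g) by rewrite /mul /= mulg1.
have [W [oW W1 Wc Wd sW]] := msmooth_at_chart (lie_mul_smooth (1, 1)%g) acc ac cc1 c11.
pose m : F * F -> F := cmap c \o mul \o cinv (prod_chart c c).
have Dm w : 'd m (c0, c0) (0, w) = w.
  have dmul := msmooth_at_mderivable (lie_mul_smooth (1, 1)%g : msmooth_at mul (1, 1)%g).
  have [_ /(_ (0, w))] := mderivable_chart dmul acc ac cc1 c11.
  have -> : tchange (chart_at (1, 1)%g) (prod_chart c c) (1, 1)%g (0, w) = (0, w).
    exact: (congr1 (@^~ (0, w)) (tchange_id cc1)).
  have [_ e] := mdiff_partial_r dmul; rewrite -e /mul /=.
  have -> : (fun b : G => (1 * b)%g) = id by apply/funext => b; exact: mul1g.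
  rewrite (mdiff_id _).2 mulg1 => e2; apply: etrans e2 _.
  exact: (congr1 (@^~ w) (tchange_id c1)).
have Hs : \forall d \near (0 : R)^'+, forall x y : F * F,
    `|x - (c0, c0)| < d -> `|y - (c0, c0)| < d ->
    `|m x - m y - 'd m (c0, c0) (x - y)| <= eps * `|x - y|.
  exact (@C1_strict R (F * F)%type F (findim_prod fF fF) _ W m (c0, c0) oW W1 (sW 1%N) eps eps0).
have [r /= r0 Hr] : nbhs_ball (c0, c0) W by apply/nbhs_ballP; exact: open_nbhs_nbhs.
near=> d => a b ca cb ad bd.
have dr : d <= r by near: d; exact: nbhs_right_le.
have Wab : W (cmap c a, cmap c b).
  apply: Hr; split; rewrite -ball_normE /ball_ /= distrC.
    exact: lt_le_trans ad dr.
  exact: lt_le_trans bd dr.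
split; first by have := Wd _ Wab; rewrite /= !cmapK.
have H : forall x y : F * F, `|x - (c0, c0)| < d -> `|y - (c0, c0)| < d ->
    `|m x - m y - 'd m (c0, c0) (x - y)| <= eps * `|x - y|.
  by near: d; exact: Hs.
have d0 : 0 < d by apply: le_lt_trans ad.
(* The two points compared are [(a, b)] and [(a, 1)], so their difference has zero first
   component. *)
have := H (cmap c a, cmap c b) (cmap c a, c0).
rewrite -![(_, _) - (_, _)]/(_ - _, _ - _) !subrr Dm !prod_normE /= normr0.
rewrite !gt_max ad bd d0 (max_idPr _)// => /(_ isT isT).
by rewrite /m /= /mul /= !cmapK// mulg1.
Unshelve. all: by end_near. Qed.

(** Each further factor [b] adds [cmap c b - c0] up to half its length, by [lie_mul_near] with
    constant 1/2; the errors add up. *)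
Lemma lie_pow_near : exists2 d : R, 0 < d & forall (b : G) (N : nat), cdom c b ->
  2 * (N%:R * `|cmap c b - c0|) < d ->
  cdom c (b ^+ N)%g /\
  `|cmap c (b ^+ N)%g - c0 - N%:R *: (cmap c b - c0)| <= 2^-1 * (N%:R * `|cmap c b - c0|).
Proof.
have c1 : cdom c 1%g by exact: chart_at_dom.
have h0 : 0 < 2^-1 :> R by rewrite invr_gt0.
near (0 : R)^'+ => d.
have d0 : 0 < d by [].
have H : forall a b : G, cdom c a -> cdom c b -> `|cmap c a - c0| < d ->
    `|cmap c b - c0| < d -> cdom c (a * b)%g /\
    `|cmap c (a * b)%g - cmap c a - (cmap c b - c0)| <= 2^-1 * `|cmap c b - c0|.
  by near: d; exact: lie_mul_near.
exists d => // b N cb; elim: N => [|N IH].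
  by rewrite !mul0r !mulr0 scale0r subr0 /= subrr normr0.
set w := cmap c b - c0 in IH *; rewrite -[N.+1%:R]natr1 => Nd.
have w0 : 0 <= `|w| by [].
have N0 : 0 <= N%:R * `|w| :> R by exact: mulr_ge0.
move: Nd; rewrite [(N%:R + 1) * _]mulrDl mul1r => Nd.
have [] := IH.
  have lin (A B C : R) : 0 <= B -> 2 * (A + B) < C -> 2 * A < C by lra.
  exact: lin w0 Nd.
move=> cN eN; have bd : `|w| < d.
  have lin (A B C : R) : 0 <= A -> 0 <= B -> 2 * (A + B) < C -> B < C by lra.
  exact: lin N0 w0 Nd.
(* By the induction hypothesis this distance is at most 3/2 of N times the norm of [w]; the factor 2
   in the hypothesis puts it below [d], so the next multiplication is covered. *)
have aN : `|cmap c (b ^+ N)%g - c0| < d.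
  have -> : cmap c (b ^+ N)%g - c0 = (cmap c (b ^+ N)%g - c0 - N%:R *: w) + N%:R *: w.
    by rewrite subrK.
  apply: le_lt_trans (ler_normD _ _) _; rewrite normrZ normr_nat.
  have lin (A B C D : R) : 0 <= A -> 0 <= B -> 2 * (A + B) < C -> D <= 2^-1 * A ->
    D + A < C by lra.
  exact: lin N0 w0 Nd eN.
have [cM eM] := H _ _ cN cb aN bd.
rewrite expgSr; split=> //.
have -> : cmap c (b ^+ N * b)%g - c0 - (N%:R + 1) *: w =
    (cmap c (b ^+ N * b)%g - cmap c (b ^+ N)%g - w) + (cmap c (b ^+ N)%g - c0 - N%:R *: w).
  rewrite scalerDl scale1r opprD.
  rewrite [X in _ = X + _]addrAC -[X in _ = _ + X]addrA subrKA.
  by rewrite [RHS]addrACA [- w - _]addrC.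
by apply: le_trans (ler_normD _ _) _; rewrite mulrDr addrC lerD.
Unshelve. all: by end_near. Qed.
End LieNear.

Section DiscreteKernel.
Context {R : realType} {n k : nat}.
Context {Gam : lieGroupType 'cV[R]_n} {G : lieGroupType 'cV[R]_k}.

Lemma diff0_little (E F : normedModType R) (f : E -> F) x w :
  differentiable f x -> 'd f x w = 0 -> forall eps, 0 < eps ->
  \forall t \near (0 : R)^'+, `|f (x + t *: w) - f x| <= eps * t.
Proof.
move=> df dw eps eps0; have := diff_derivable (v := w) df; rewrite /derivable => cf.
have : h^-1 *: ((f \o shift x) (h *: w) - f x) @[h --> 0^'] --> (0 : F).
  by have := deriveE w df; rewrite dw /derive => <-.
move=> /(@cvgr0Pnorm_le _ _ _ _ _)/(_ eps eps0) H.
have {}H : \forall t \near (0 : R)^'+, `|t^-1 *: ((f \o shift x) (t *: w) - f x)| <= eps.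
  move: H; rewrite !near_withinE; apply: filterS => t H t0; apply: H.
  by rewrite gt_eqF.
near=> t; have t0 : 0 < t by [].
have : `|t^-1 *: ((f \o shift x) (t *: w) - f x)| <= eps by near: t.
rewrite normrZ gtr0_norm ?invr_gt0// mulrC ler_pdivrMr//=.
by rewrite [x + _]addrC.
Unshelve. all: by end_near. Qed.

Lemma hom_pow (rho : Gam -> G) : (forall a b, rho (a * b)%g = (rho a * rho b)%g) ->
  rho 1%g = 1%g /\ forall a N, rho (a ^+ N)%g = (rho a ^+ N)%g.
Proof.
move=> rhoM; have r1 : rho 1%g = 1%g.
  by apply: (@mulgI _ (rho 1%g)); rewrite -rhoM !mulg1.
by split=> // a; elim=> [|N IH] //; rewrite !expgS rhoM IH.
Qed.

(* If the derivative kills w, then for b near 1 in direction w / N the power b^N stays in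
   a compact neighbourhood of w that avoids the kernel, while rho(b)^N tends to 1. *)
Lemma discrete_kernel_mdiff_inj (rho : Gam -> G) : msmooth rho ->
  (forall a b, rho (a * b)%g = (rho a * rho b)%g) ->
  (exists2 U : set Gam, open U & U `&` [set b | rho b = 1%g] = [set 1%g]) ->
  injective (mdiff rho 1%g).
Proof.
move=> srho rhoM [U oU UE]; have [r1 rX] := hom_pow rhoM.
suff H v : mdiff rho 1%g v = 0 -> v = 0.
  by move=> x y xy; apply/eqP; rewrite -subr_eq0; apply/eqP/H; rewrite mdiffB xy subrr.
move=> dv0; apply/eqP/negPn/negP => v0.
have vpos : 0 < `|v| by rewrite normr_gt0.
pose c : chart 'cV[R]_n Gam := chart_at 1%g; pose c0 := cmap c 1%g.
pose d : chart 'cV[R]_k G := chart_at 1%g; pose d0 := cmap d 1%g.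
have c1 : cdom c 1%g by exact: chart_at_dom.
have d1 : cdom d 1%g by exact: chart_at_dom.
have U1 : U 1%g by have : [set 1%g] (1%g : Gam) by []; rewrite -UE => -[].
have [del1 del10 pow1] := @lie_pow_near R _ _ Gam.
have [del2 del20 pow2] := @lie_pow_near R _ _ G.
have [r0 /= r00 Hr0] : nbhs_ball c0 (fun y => (cmap c @` cdom c) y /\ U (cinv c y)).
  apply/nbhs_ballP; apply: filterI; first exact: (near_cimg c1).
  by apply: near_cinv c1 _; exact: open_nbhs_nbhs.
(* Scaling gives [w] the norm [min(del1, r0) / 4]: twice it is below [del1], for the power estimate,
   and below [r0], so that [K] stays in the chart and in [U]. *)
pose s := Num.min del1 r0 / (4 * `|v|).
have min0 : 0 < Num.min del1 r0 by rewrite lt_min del10.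
have s0 : 0 < s by rewrite divr_gt0// mulr_gt0.
pose w := s *: v.
have nw : `|w| = Num.min del1 r0 / 4.
  by rewrite normrZ gtr0_norm// /s invfM mulrA mulfVK// gt_eqF.
have w0 : 0 < `|w| by rewrite nw divr_gt0.
have w1 : 2 * `|w| < del1.
  have : Num.min del1 r0 <= del1 by rewrite ge_min lexx.
  by rewrite nw; move: min0; set A := Num.min _ _ ; lra.
have w2 : 2 * `|w| < r0.
  have : Num.min del1 r0 <= r0 by rewrite ge_min lexx orbT.
  by rewrite nw; move: min0; set A := Num.min _ _ ; lra.
have dw0 : mdiff rho 1%g w = 0 by rewrite /w /mdiff linearZ /= -/(mdiff rho 1%g v) dv0 scaler0.
(* This is exactly where [lie_pow_near] puts the N-th power of an element with coordinates
   [c0 + w / N]; its radius, half the norm of [w], excludes [c0]. *)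
pose K : set 'cV[R]_n := [set y | `|y - (c0 + w)| <= 2^-1 * `|w|].
have KB y : K y -> ball c0 r0 y.
  rewrite /K /= -ball_normE /ball_ /= => yK; rewrite distrC.
  have -> : y - c0 = (y - (c0 + w)) + w by rewrite opprD addrA subrK.
  apply: le_lt_trans (ler_normD _ _) _.
  have lin (A B C : R) : A <= 2^-1 * B -> 0 < B -> 2 * B < C -> A + B < C by lra.
  exact: lin yK w0 w2.
pose h y := rho (cinv c y).
have hc y : (cmap c @` cdom c) y -> {for y, continuous h}.
  move=> cy; apply: continuous_comp; first exact: cinv_continuous.
  exact: (msmooth_at_mderivable (srho _)).1.
have cK : compact (h @` K).
  apply: continuous_compact; last exact: mx_closed_ball_compact.
  apply: continuous_in_subspaceT => y /set_mem/KB/Hr0[cy _]; exact: hc.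
have clK : closed (h @` K) by apply: compact_closed => //; exact: manifold_hausdorff.
(* A kernel element in [U] is 1, with coordinates [c0], at distance from [c0 + w] larger than the
   radius of [K]. *)
have nK1 : ~ (h @` K) 1%g.
  move=> [y Ky hy]; have [cy Uy] := Hr0 _ (KB _ Ky).
  have : (U `&` [set b | rho b = 1%g]) (cinv c y) by split.
  rewrite UE => /= y1; have yc : y = c0 by rewrite -(cimgK cy) y1.
  move: Ky; rewrite /K /= yc opprD addrA subrr sub0r normrN.
  by have lin (A : R) : 0 < A -> A <= 2^-1 * A -> False by [lra|]; move=> /(lin _ w0).
have [r /= r'0 Hr] : nbhs_ball d0 (fun z => ~ (h @` K) (cinv d z)).
  apply/nbhs_ballP; apply: (@near_cinv _ _ _ d 1%g (fun z => ~ (h @` K) z)) => //.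
  by apply: open_nbhs_nbhs; split => //; exact: closed_openC.
(* The powers of [rho b] will be at distance at most [3/2 * eta] from [d0]: the factor 1/4 puts this
   below [r] and meets the hypothesis of [pow2]. *)
pose eta := Num.min del2 r / 4.
have min20 : 0 < Num.min del2 r by rewrite lt_min del20.
have eta0 : 0 < eta by rewrite divr_gt0.
have e1 : 2 * eta < del2.
  have : Num.min del2 r <= del2 by rewrite ge_min lexx.
  by rewrite /eta; move: min20; set A := Num.min _ _ ; lra.
have e2 : 2 * eta < r.
  have : Num.min del2 r <= r by rewrite ge_min lexx orbT.
  by rewrite /eta; move: min20; set A := Num.min _ _ ; lra.
have drho := msmooth_at_mderivable (srho 1%g).
have dr1 : cdom d (rho 1%g) by rewrite r1.
have [df ef] := mderivable_chart drho (chart_at_atlas _) (chart_at_atlas _) c1 dr1.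
have dfw : 'd (cmap d \o rho \o cinv c) c0 w = 0.
  have := ef w; have -> : tchange (chart_at 1%g) c 1%g w = w.
    exact: (congr1 (@^~ w) (tchange_id c1)).
  by rewrite dw0 linear0.
have small : \forall t \near (0 : R)^'+,
    `|cmap d (h (c0 + t *: w)) - d0| <= eta * t.
  have := diff0_little df dfw eta0; apply: filterS => t.
  by rewrite /= cmapK// r1.
have dom : \forall t \near (0 : R)^'+,
    (cmap c @` cdom c) (c0 + t *: w) /\ cdom d (h (c0 + t *: w)).
  have nd : \forall y \near c0, (cmap c @` cdom c) y /\ cdom d (h y).
    apply: filterI; first exact: (near_cimg c1).
    apply: (near_cinv (P := fun a => cdom d (rho a)) c1).
    by apply: drho.1; apply: near_cdom; rewrite r1.
  have ct : (fun t : R => c0 + t *: w) @ (0 : R)^'+ --> c0.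
    apply: cvg_at_right_filter; rewrite -[X in _ --> X]addr0 -[X in _ --> _ + X](scale0r w).
    by apply: cvgD; [exact: cvg_cst|exact: cvgZr_tmp].
  exact: ct nd.
have [t0 /= t00 Ht0] : nbhs_ball (0 : R) (fun t => 0 < t ->
    `|cmap d (h (c0 + t *: w)) - d0| <= eta * t /\
    (cmap c @` cdom c) (c0 + t *: w) /\ cdom d (h (c0 + t *: w))).
  by apply/nbhs_ballP; exact: (filterI small dom).
have [N Nt] : exists N : nat, N.+1%:R^-1 < t0.
  by have [N _ /(_ N (leqnn N))] := near_infty_natSinv_lt (PosNum t00); exists N.
have N0 : 0 < N.+1%:R^-1 :> R by rewrite invr_gt0.
have [|sm [cb db]] := Ht0 N.+1%:R^-1 _ N0.
  by rewrite -ball_normE /ball_ /= sub0r normrN gtr0_norm.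
pose b := cinv c (c0 + N.+1%:R^-1 *: w).
have cbK : cmap c b - c0 = N.+1%:R^-1 *: w by rewrite /b cimgK// addrAC subrr add0r.
have Nn : N.+1%:R * `|cmap c b - c0| = `|w|.
  by rewrite cbK normrZ gtr0_norm// mulrA mulfV ?mul1r// pnatr_eq0.
have [|cbN ebN] := pow1 b N.+1 (cimg_dom cb); first by rewrite Nn.
have KN : K (cmap c (b ^+ N.+1)%g).
  by move: ebN; rewrite Nn cbK scalerA mulfV ?pnatr_eq0// scale1r /K /= opprD addrA.
have Nr : N.+1%:R * `|cmap d (rho b) - d0| <= eta.
  by rewrite mulrC -ler_pdivlMr.
have [|drN erN] := pow2 (rho b) N.+1 db.
  by apply: le_lt_trans e1; rewrite ler_pM2l.
have : ball d0 r (cmap d (rho b ^+ N.+1)%g).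
  rewrite -ball_normE /ball_ /= distrC.
  have -> : cmap d (rho b ^+ N.+1)%g - d0 =
    (cmap d (rho b ^+ N.+1)%g - d0 - N.+1%:R *: (cmap d (rho b) - d0)) +
    N.+1%:R *: (cmap d (rho b) - d0) by rewrite subrK.
  apply: le_lt_trans (ler_normD _ _) _; rewrite normrZ normr_nat.
  have lin (A B : R) : A <= 2^-1 * B -> B <= eta -> A + B < r by move: e2 eta0; lra.
  exact: lin erN Nr.
(* The contradiction: the same element is [rho (b ^+ N.+1)], in the image of [K], and
   [rho b ^+ N.+1], in the ball that avoids this image. *)
move=> /Hr; rewrite cmapK// -rX; apply.
by exists (cmap c (b ^+ N.+1)%g) => //; rewrite /h cmapK.
Qed.
End DiscreteKernel.

(** * Smooth surjections do not raise the dimension *)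

Section Dimension.
Context {R : realType}.

Lemma mx_norm_le m n (x : 'M[R]_(m, n)) e : 0 <= e ->
  (forall i j, `|x i j| <= e) -> `|x| <= e.
Proof.
by move=> e0 H; rewrite /Num.norm /= mx_normrE; apply/bigmax_leP; split=> // -[i j].
Qed.

Lemma mx_norm_ge m n (x : 'M[R]_(m, n)) i j : `|x i j| <= `|x|.
Proof.
rewrite [leRHS]/Num.norm /= mx_normrE.
exact: (le_bigmax _ (fun ij : 'I_m * 'I_n => `|x ij.1 ij.2|) (i, j)).
Qed.

(* Count: a grid of D^k points of the ball at mutual distance del / D needs pairwise
   distinct cells among the O(D)^n cells of a subdivision of the cube of dimension n. *)
Lemma lipschitz_ball_dim n k (f : 'cV[R]_n -> 'cV[R]_k) a r L b del : 0 < r -> 0 <= L ->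
  0 < del -> (forall x y, `|x - a| <= r -> `|y - a| <= r -> `|f x - f y| <= L * `|x - y|) ->
  ball b del `<=` f @` [set x | `|x - a| <= r] -> (k <= n)%N.
Proof.
move=> r0 L0 del0 Lf sub; rewrite leqNgt; apply/negP => nk.
(* [A] is chosen so that points in one cell of side [2 * r / (A * D)] have images closer than
   [del / D], the mesh of the grid. *)
pose A := (Num.trunc (2 * r * L / del)).+1.
have A0 : 0 < A%:R :> R by rewrite ltr0n.
have AP : 2 * r * L / del < A%:R.
  have /truncn_itv/andP[_] : 0 <= 2 * r * L / del by rewrite divr_ge0 ?mulr_ge0// ltW.
  exact.
suff H D : (0 < D)%N -> (D ^ k <= (A * D).+1 ^ n)%N.
  (* If [n < k], the bound gives [D ^ n.+1 <= (A.+1 * D) ^ n], hence [D <= A.+1 ^ n], which this [D]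
     violates. *)
  pose D := (A.+1 ^ n).+1.
  have D1 : ((A * D).+1 <= A.+1 * D)%N by rewrite mulSn -add1n leq_add2r.
  have Dn : ((A * D).+1 ^ n <= (A.+1 * D) ^ n)%N.
    by have [->|n0] := posnP n; rewrite ?expn0// leq_exp2r.
  have := leq_trans (H D isT) Dn.
  have : (D ^ n.+1 <= D ^ k)%N by rewrite leq_pexp2l.
  move=> /leq_trans/[apply]; rewrite expnMn expnS leq_pmul2r ?expn_gt0//.
  by rewrite /D ltnn.
move=> D0; have DR : 0 < D%:R :> R by rewrite ltr0n.
have AD0 : 0 < (A * D)%:R :> R by rewrite ltr0n muln_gt0.
pose sig := del / D%:R; have sig0 : 0 < sig by rewrite divr_gt0.
(* The indices stop at [D.-1], so the grid stays strictly inside the open ball of radius [del]. *)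
pose p (g : {ffun 'I_k -> 'I_D}) : 'cV[R]_k := b + \col_i (sig * (g i)%:R).
have pB g : ball b del (p g).
  rewrite -ball_normE /ball_ /= /p opprD addrA subrr sub0r normrN.
  apply: (@le_lt_trans _ _ (sig * D.-1%:R)).
    apply: mx_norm_le => [|i j]; first by rewrite mulr_ge0// ltW.
    rewrite mxE ger0_norm; last by rewrite mulr_ge0// ltW.
    by rewrite ler_pM2l// ler_nat -ltnS prednK.
  by rewrite /sig mulrAC ltr_pdivrMr// ltr_pM2l// ltr_nat prednK.
have P g : exists x, `|x - a| <= r /\ f x = p g.
  by have [x ? ?] := sub _ (pB g); exists x.
pose X g := projT1 (cid (P g)).
have Xr g : `|X g - a| <= r by rewrite /X; case: cid => x [].
have Xp g : f (X g) = p g by rewrite /X; case: cid => x [].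
pose u (x : 'cV[R]_n) i := (x i 0 - a i 0 + r) * ((A * D)%:R / (2 * r)).
have r20 : 0 < 2 * r by rewrite mulr_gt0.
have uP g i : 0 <= u (X g) i <= (A * D)%:R.
  have := le_trans (mx_norm_ge (X g - a) i 0) (Xr g).
  rewrite !mxE ler_norml => /andP[l1 l2].
  rewrite /u mulr_ge0 ?divr_ge0 ?(ltW r20)//=; last by rewrite -lerBlDr sub0r.
  rewrite mulrA ler_pdivrMr// mulrC ler_pM2l//.
  by rewrite mulr_natl mulr2n lerD2r.
(* [u] rescales the cube to [[0, A * D]] in each coordinate; the right end point is attained, whence
   [A * D + 1] cell indices. *)
pose h g : {ffun 'I_n -> 'I_(A * D).+1} := [ffun i => inord (Num.trunc (u (X g) i))].
suff hinj : injective h.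
  by have := leq_card _ hinj; rewrite !card_ffun !card_ord.
move=> g g' hg; apply/ffunP => i; apply/val_inj => /=; apply/eqP/negPn/negP => gi.
have sep : sig <= `|p g - p g'|.
  apply: le_trans (mx_norm_ge _ i 0).
  rewrite !mxE opprD addrACA subrr add0r -mulrBr normrM gtr0_norm//.
  rewrite ler_pMr//.
  have [lt|lt|/eqP] := ltngtP (g i) (g' i); last by rewrite (negPf gi).
    by rewrite distrC ger0_norm ?subr_ge0 ?ler_nat ?(ltnW lt)// -natrB ?(ltnW lt)// ler1n subn_gt0.
  by rewrite ger0_norm ?subr_ge0 ?ler_nat ?(ltnW lt)// -natrB ?(ltnW lt)// ler1n subn_gt0.
have close : `|X g - X g'| <= 2 * r / (A * D)%:R.
  apply: mx_norm_le => [|l j]; first by rewrite divr_ge0 ?(ltW r20) ?(ltW AD0).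
  rewrite ord1 !mxE.
  have tr g1 : (Num.trunc (u (X g1) l))%:R <= u (X g1) l < (Num.trunc (u (X g1) l)).+1%:R.
    by apply: truncn_itv; have /andP[] := uP g1 l.
  have trN g1 : (Num.trunc (u (X g1) l) < (A * D).+1)%N.
    rewrite ltnS -(ler_nat R); have /andP[t1 _] := tr g1.
    by apply: le_trans t1 _; have /andP[] := uP g1 l.
  have : Num.trunc (u (X g) l) = Num.trunc (u (X g') l).
    have : h g l = h g' l by rewrite hg.
    by rewrite !ffunE => /(congr1 val); rewrite /= !inordK.
  move: (tr g) (tr g') => /andP[t1 t2] /andP[t3 t4] tE; rewrite -tE in t3 t4.
  have : `|u (X g) l - u (X g') l| <= 1.
    rewrite ler_norml; move: t1 t2 t3 t4; rewrite -!natr1.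
    by set x1 := u _ _; set x2 := u _ _; set x3 := _%:R; lra.
  rewrite /u -mulrBl opprD addrACA subrr addr0 opprB addrA subrK.
  by rewrite normrM (gtr0_norm (divr_gt0 AD0 r20)) -ler_pdivlMr ?divr_gt0// invf_div mul1r.
have := Lf _ _ (Xr g) (Xr g'); rewrite !Xp => /(le_trans sep).
apply/negP; rewrite -ltNge.
apply: (@le_lt_trans _ _ (L * (2 * r / (A * D)%:R))); first by rewrite ler_wpM2l.
have -> : L * (2 * r / (A * D)%:R) = 2 * r * L / A%:R / D%:R.
  by rewrite natrM; field; rewrite !gt_eqF.
rewrite /sig ltr_pM2r ?invr_gt0// ltr_pdivrMr// [del * _]mulrC.
by rewrite -ltr_pdivrMr.
Qed.
End Dimension.

(** Declares matrices complete as normed modules, the form in which Baire's theorem is applied to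
    the chart image. *)
HB.instance Definition _ (R : realType) m n := Complete.on 'M[R]_(m, n).

(** If no member contained a ball, the complements would be open and dense, and by Baire a point of
    [O] would avoid them all. *)
Lemma countable_closed_cover_ball (R : realType) (V : completeNormedModType R)
    (S : set (set V)) (O : set V) : countable S -> (forall A, S A -> closed A) ->
  open O -> O !=set0 -> O `<=` \bigcup_(A in S) A ->
  exists A b del, [/\ S A, 0 < del & ball b del `<=` A].
Proof.
move=> /countable_injP[e inje] clS oO O0 OS; apply: contrapT => noball.
(* The complement of the member with code [i]; the empty intersection gives the whole space at codes
   that are not taken. *)
pose U i := \bigcap_(A in [set A | S A /\ e A = i]) ~` A.
have UE A : S A -> U (e A) = ~` A.
  move=> SA; apply/seteqP; split=> x; first by apply.
  by move=> nAx B [SB eB]; rewrite (inje _ _ _ _ eB) ?inE.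
have oU i : open (U i) /\ dense (U i).
  have [[A [SA <-]]|none] := pselect (exists A, S A /\ e A = i); last first.
    have -> : U i = setT by apply/seteqP; split=> // x _ A SA; case: none; exists A.
    split; first exact: openT.
    by move=> D D0 _; rewrite setIT.
  rewrite UE//; split; first by apply: closed_openC; exact: clS.
  move=> D [x Dx] oD; apply: contrapT => /set0P/negP/negPn/eqP DA.
  have /nbhs_ballP[d /= d0 Hd] : nbhs x D by exact: open_nbhs_nbhs.
  apply: noball; exists A, x, d; split=> // y /Hd Dy; apply: contrapT => nAy.
  by have : (D `&` ~` A) y by []; rewrite DA.
have [x [Ox Ux]] := Baire oU O0 oO.
have [A SA Ax] := OS _ Ox.
by have := Ux (e A) I; rewrite UE.
Qed.

Section SurjectiveDimension.
Context {R : realType} {n k : nat} {M : manifoldType 'cV[R]_n} {N : manifoldType 'cV[R]_k}.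

Lemma rat_cV_near (a : 'cV[R]_n) e : 0 < e ->
  exists q : 'cV[rat]_n, `|a - map_mx ratr q| <= e.
Proof.
move=> e0; have P i : exists q, ratr q \in `](a i 0), (a i 0 + e)[.
  by apply: rat_in_itvoo; rewrite ltrDl.
exists (\col_i projT1 (cid (P i))); apply: mx_norm_le => [|i j]; first exact: ltW.
rewrite ord1 !mxE; case: cid => q /=; rewrite in_itv /= => /andP[q1 q2].
by rewrite distrC gtr0_norm ?subr_gt0// lerBlDl ltW.
Qed.

(* Charts of a countable cover and balls with rational data reduce the claim, by Baire,
   to the Lipschitz image of one ball. *)
Lemma msmooth_surj_dim (f : M -> N) : msmooth f -> (forall y, exists x, f x = y) ->
  forall y0 : N, (k <= n)%N.
Proof.
move=> sf fsurj y0; pose d : chart 'cV[R]_k N := chart_at y0.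
have ad : atlas d by exact: chart_at_atlas.
have [A cA [Aa AT]] := @manifold_countable R _ M.
pose F (c : chart 'cV[R]_n M) := cmap d \o f \o cinv c.
pose B (q : 'cV[rat]_n) (i : nat) := [set y : 'cV[R]_n | `|y - map_mx ratr q| <= i.+1%:R^-1].
(* Continuity makes the image of the ball compact, hence closed, for Baire; the Lipschitz bound is
   for the counting argument. *)
pose good (z : chart 'cV[R]_n M * ('cV[rat]_n * nat)) :=
  (forall y, B z.2.1 z.2.2 y -> {for y, continuous (F z.1)}) /\
  exists2 L, 0 <= L & forall x y, B z.2.1 z.2.2 x -> B z.2.1 z.2.2 y ->
    `|F z.1 x - F z.1 y| <= L * `|x - y|.
pose S := [set F z.1 @` B z.2.1 z.2.2 | z in (A `*` setT) `&` good].
have cS : countable S.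
  apply: sub_countable (card_image_le _ _) _.
  apply: sub_countable (subset_card_le (@subIsetl _ _ _)) _.
  by apply: countableX => //; exact: countableP.
have clS D : S D -> closed D.
  move=> [z [_ [cz _]] <-]; apply: compact_closed; first exact: norm_hausdorff.
  apply: continuous_compact; last exact: mx_closed_ball_compact.
  by apply: continuous_in_subspaceT => y /set_mem; exact: cz.
have cover : cmap d @` cdom d `<=` \bigcup_(D in S) D.
  move=> _ [y dy <-]; have [x xy] := fsurj y.
  have [c Ac cx] : (\bigcup_(c in A) cdom c) x by rewrite AT.
  have ac := Aa _ Ac; have dfx : cdom d (f x) by rewrite xy.
  have [W [oW Wx Wc Wd sW]] := msmooth_at_chart (sf x) ac ad cx dfx.
  have Hs : \forall e \near (0 : R)^'+, forall y z, `|y - cmap c x| < e ->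
     `|z - cmap c x| < e -> `|F c y - F c z - 'd (F c) (cmap c x) (y - z)| <= 1 * `|y - z|.
    exact (@C1_strict R _ _ (findim_mx _ _) (findim_mx _ _) W (F c) (cmap c x)
      oW Wx (sW 1%N) 1 ltr01).
  have [r /= r0 Hr] : nbhs_ball (cmap c x) W by apply/nbhs_ballP; exact: open_nbhs_nbhs.
  near (0 : R)^'+ => e.
  have e0 : 0 < e by [].
  have er : e <= r by near: e; exact: nbhs_right_le.
  have He : forall y z, `|y - cmap c x| < e -> `|z - cmap c x| < e ->
     `|F c y - F c z - 'd (F c) (cmap c x) (y - z)| <= 1 * `|y - z| by near: e.
  (* The centre [q] and the points of its ball are each within [1 / i.+1] of their neighbour in the
     triangle inequality, so the ball lies within [e] of [cmap c x]. *)
  have [i Hi] : exists i : nat, i.+1%:R^-1 < e / 2.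
    have e20 : 0 < e / 2 by rewrite divr_gt0.
    by have [i _ /(_ i (leqnn i))] := near_infty_natSinv_lt (PosNum e20); exists i.
  have i0 : 0 < i.+1%:R^-1 :> R by rewrite invr_gt0.
  have [q Hq] := rat_cV_near (cmap c x) i0.
  have Bx y1 : B q i y1 -> `|y1 - cmap c x| < e.
    move=> By; rewrite -(subrK (map_mx ratr q) y1) -addrA.
    apply: le_lt_trans (ler_normD _ _) _; rewrite [`|_ - cmap c x|]distrC.
    by move: By Hq Hi; rewrite /B /=; set a1 := `|_|; set a2 := `|_|; set a3 := _^-1; lra.
  have dF : differentiable (F c) (cmap c x) by exact: ((sW 1%N).1 _ Wx).
  have [K K0 HK] := linear_lipschitz (diff_continuous dF).
  exists (F c @` B q i); last by exists (cmap c x) => //=; rewrite /F /= cmapK// xy.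
  exists (c, (q, i)); last by [].
  split; first by split.
  split.
    move=> y1 /Bx y1e; apply: (sW 0 y1); apply: Hr.
    by rewrite -ball_normE /ball_ /= distrC; exact: lt_le_trans er.
  (* 1 from strict differentiability, [K] from the differential. *)
  exists (1 + K) => [|y1 y2 /Bx b1 /Bx b2]; first by rewrite addr_ge0// ltW.
  rewrite -(subrK ('d (F c) (cmap c x) (y1 - y2)) (F c y1 - F c y2)).
  apply: le_trans (ler_normD _ _) _; rewrite mulrDl lerD//; exact: He.
have O0 : (cmap d @` cdom d) !=set0 by exists (cmap d y0), y0 => //; exact: chart_at_dom.
have [D [b [del [[z [_ [_ [L L0 HL]]] <-] del0 sub]]]] :=
  countable_closed_cover_ball cS clS (cimg_open d) O0 cover.
apply: (lipschitz_ball_dim _ L0 del0 HL sub).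
by rewrite invr_gt0.
Unshelve. all: by end_near. Qed.
End SurjectiveDimension.

Section CentralHom.
Context {R : realType} {n k : nat}.
Context {Gam : lieGroupType 'cV[R]_n} {G : lieGroupType 'cV[R]_k}.

Lemma linear_inj_surj (f : {linear 'cV[R]_n -> 'cV[R]_k}) : (k <= n)%N ->
  injective f -> forall y, exists x, f x = y.
Proof.
move=> kn inj y; pose h := linfun f.
have k0 : lker h == 0%VS.
  by apply/lker0P => u v; rewrite !lfunE; exact: inj.
have : (limg h == fullv)%VS.
  rewrite eqEdim subvf /=.
  rewrite limg_dim_eq; last by rewrite (eqP k0) capv0.
  by rewrite !dimvf /dim /= !muln1.
move=> /eqP hT; have : y \in limg h by rewrite hT memvf.
by move=> /memv_imgP[x _ ->]; exists x; rewrite lfunE.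
Qed.

Lemma central_hom_mdiff_bij (rho : Gam -> G) : central_hom rho ->
  injective (mdiff rho 1%g) /\ forall y, exists x, mdiff rho 1%g x = y.
Proof.
move=> [srho rhoM rsurj rdisc _].
have [r1 _] := hom_pow rhoM.
have inj := discrete_kernel_mdiff_inj srho rhoM (rdisc _ r1).
split=> //; apply: linear_inj_surj => //.
exact: (msmooth_surj_dim srho rsurj 1%g).
Qed.
End CentralHom.

(** * The tangent map of a Gamma-structure *)

Section GammaTangent.
Context {R : realType} {E EP EP' : normedModType R} {n k : nat}.
Context {M : manifoldType E} {G : lieGroupType 'cV[R]_k} {Gam : lieGroupType 'cV[R]_n}.
Context {P : manifoldType EP} {Pt : manifoldType EP'}.
Context (rho : Gam -> G) (pit : Pt -> M) (actt : Pt -> Gam -> Pt)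
  (pi : P -> M) (act : P -> G -> P) (zeta : Pt -> P).
Context (B : principal_bundle pi act) (Bt : principal_bundle pit actt)
  (cr : central_hom rho) (gz : gamma_structure rho pit actt pi act zeta).

Lemma gamma_mderivable u : mderivable zeta u.
Proof. by have [/(_ u)/msmooth_at_mderivable] := gz. Qed.

Lemma mdiff_gamma_orbit u tau : mdiff zeta u (mdiff (actt u) 1%g tau) =
  mdiff (act (zeta u)) 1%g (mdiff rho 1%g tau).
Proof.
have [srho rhoM _ _ _] := cr; have [r1 _] := hom_pow rhoM; have [_ _ zact] := gz.
have [_ _ [act1 _] _ _] := Bt.
have [_ e1] := mdiff_comp (bundle_orbit_mderivable Bt u 1%g) (gamma_mderivable _).
have dr := msmooth_at_mderivable (srho 1%g).
have dorb : mderivable (act (zeta u)) (rho 1%g) by exact: (bundle_orbit_mderivable B).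
have [_ e2] := mdiff_comp dr dorb.
have := e1 tau; rewrite act1 => <-.
have -> : zeta \o actt u = act (zeta u) \o rho by apply/funext => a /=; exact: zact.
by rewrite e2 r1.
Qed.

Lemma mdiff_gamma_proj u v : mdiff pi (zeta u) (mdiff zeta u v) = mdiff pit u v.
Proof.
have [_ zpi _] := gz.
have [_ <-] := mdiff_comp (gamma_mderivable u) (bundle_proj_mderivable B (zeta u)).
by congr (mdiff _ _ _); apply/funext => x /=; exact: zpi.
Qed.

Lemma mdiff_gamma_inj u : injective (mdiff zeta u).
Proof.
suff H v : mdiff zeta u v = 0 -> v = 0.
  by move=> x y xy; apply/eqP; rewrite -subr_eq0; apply/eqP/H; rewrite mdiffB xy subrr.
move=> v0.
have [tau vt] : exists tau, v = mdiff (actt u) 1%g tau.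
  by apply: (mdiff_vertical Bt); rewrite -mdiff_gamma_proj v0 mdiff0.
move: v0; rewrite vt mdiff_gamma_orbit -(mdiff0 (act (zeta u)) 1%g).
move=> /(mdiff_orbit_inj B); rewrite -(mdiff0 rho 1%g).
by move=> /(central_hom_mdiff_bij cr).1 ->; rewrite mdiff0.
Qed.

(** Lift the projection of [w] first; the remaining difference is vertical and is reached through
    [T_1 rho]. *)
Lemma mdiff_gamma_surj u w : exists v, mdiff zeta u v = w.
Proof.
have [v0 v0P] := mdiff_proj_surj Bt u (mdiff pi (zeta u) w).
have [tau vt] : exists tau, w - mdiff zeta u v0 = mdiff (act (zeta u)) 1%g tau.
  by apply: (mdiff_vertical B); rewrite mdiffB mdiff_gamma_proj v0P subrr.
have [s sP] := (central_hom_mdiff_bij cr).2 tau.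
exists (v0 + mdiff (actt u) 1%g s).
by rewrite mdiffD mdiff_gamma_orbit sP -vt addrC subrK.
Qed.
End GammaTangent.

(** * The frame bundle and the natural lift *)

Section MatrixExponential.
Context {R : realType} {m : nat}.
Implicit Types A B : 'M[R]_m.

Lemma mx_norm_mul A B : `|A *m B| <= m%:R * `|A| * `|B|.
Proof.
apply: mx_norm_le => [|i j]; first by rewrite !mulr_ge0.
rewrite mxE; apply: le_trans (ler_norm_sum _ _ _) _.
apply: (@le_trans _ _ (\sum_(l < m) (`|A| * `|B|))).
  by apply: ler_sum => l _; rewrite normrM ler_pM// mx_norm_ge.
by rewrite sumr_const card_ord -mulrA mulr_natl.
Qed.

Lemma mx_norm_exp A l : `|A ^+ l| <= (m%:R * `|A|) ^+ l.
Proof.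
elim: l => [|l IH].
  rewrite !expr0; apply: mx_norm_le => // i j.
  by rewrite mxE; case: eqP => _; rewrite ?mulr1n ?mulr0n ?normr1 ?normr0.
rewrite !exprS; apply: le_trans (mx_norm_mul _ _) _.
by rewrite ler_wpM2l// mulr_ge0.
Qed.

Let a A (t : R) (l : nat) : 'M[R]_m := (l`!%:R)^-1 *: (t *: A) ^+ l.

Let aE A t l : a A t l = (t ^+ l / l`!%:R) *: A ^+ l.
Proof.
rewrite /a; suff -> : (t *: A) ^+ l = t ^+ l *: A ^+ l by rewrite scalerA mulrC.
elim: l => [|l IH]; first by rewrite !expr0 scale1r.
rewrite !exprS IH -[LHS]/((t *: A) *m (_ *: _)) -scalemxAl -scalemxAr scalerA.
by [].
Qed.

(** From degree 2 on, a power of [t] is at most [t ^+ 2], which factors out of the remainder. *)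
Let a_le A t l : `|t| <= 1 -> (2 <= l)%N -> `|a A t l| <= t ^+ 2 * exp_coeff (m%:R * `|A|) l.
Proof.
move=> t1 l2; rewrite aE normrZ /exp_coeff /= normrM normfV normr_nat normrX.
rewrite mulrAC [leRHS]mulrA ler_wpM2r ?invr_ge0// ler_pM ?exprn_ge0 ?mx_norm_exp//.
by rewrite -(real_normK (num_real t)); apply: ler_wiXn2l.
Qed.

Let a_le1 A t l : `|t| <= 1 -> `|a A t l| <= exp_coeff (m%:R * `|A|) l.
Proof.
move=> t1; rewrite aE normrZ /exp_coeff /= normrM normfV normr_nat normrX.
rewrite mulrAC ler_wpM2r ?invr_ge0//.
apply: le_trans (_ : 1 * `|A ^+ l| <= _); last by rewrite mul1r mx_norm_exp.
by rewrite ler_wpM2r// exprn_ile1.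
Qed.

(** Past the linear term the series is dominated by [t ^+ 2] times the real exponential series at
    [m * |A|]; the factor [m] comes from the norm of a product in the maximum norm. *)
Lemma expmx_bound A : exists2 C : R, 0 <= C & forall t : R, `|t| <= 1 ->
  `|expmx (t *: A) - (1%:M + t *: A)| <= C * t ^+ 2.
Proof.
pose c := m%:R * `|A|; have c0 : 0 <= c by rewrite mulr_ge0.
have cc := is_cvg_series_exp_coeff c.
have part N : series (exp_coeff c) N <= expR c.
  apply: nondecreasing_cvgn_le => //; apply/nondecreasing_seqP => i.
  by rewrite seriesSr lerDl exp_coeff_ge0.
have C0 : 0 <= expR c by apply: le_trans (part 0); rewrite /series /= big_geq.
exists (expR c) => // t t1.
have cv : cvgn (series (a A t)).
  apply: normed_cvg; apply: series_le_cvg cc => l; [exact: normr_ge0|exact: exp_coeff_ge0|].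
  exact: a_le1.
(* The bound is a closed condition, so it passes from the partial sums to their limit [expmx]. *)
apply: (@closed_cvg _ 'M[R]_m \oo _ (series (a A t))
   (fun y => `|y - (1%:M + t *: A)| <= expR c * t ^+ 2) _ _ _ cv).
  have := @closed_closed_ball_ R 'M[R]_m (1%:M + t *: A) (expR c * t ^+ 2).
  congr closed; apply/funext => y; rewrite /closed_ball_ /=.
  by rewrite distrC.
near=> N; have N2 : (2 <= N)%N by near: N; exact: nbhs_infty_ge.
have -> : series (a A t) N - (1%:M + t *: A) = \sum_(2 <= l < N) a A t l.
  rewrite /series /= (big_cat_nat _ (n := 2))//= big_nat_recr//= big_nat1.
  by rewrite !aE expr0 expr1 !divr1 expr0 expr1 scale1r addrC addrK.
apply: le_trans (ler_norm_sum _ _ _) _.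
apply: (@le_trans _ _ (\sum_(2 <= l < N) t ^+ 2 * exp_coeff c l)).
  rewrite big_nat [leRHS]big_nat; apply: ler_sum => l /andP[l2 _]; exact: a_le.
rewrite -mulr_sumr mulrC ler_wpM2r ?sqr_ge0//.
apply: le_trans (part N); rewrite /series /= [leRHS](big_cat_nat _ (n := 2))//=.
by rewrite lerDr sumr_ge0// => l _; exact: exp_coeff_ge0.
Unshelve. all: by end_near. Qed.

Lemma expmx0 : expmx (0 : 'M[R]_m) = 1%:M.
Proof.
have [C C0 /(_ 0)] := expmx_bound 0.
rewrite normr0 => /(_ ler01); rewrite scaler0 addr0 expr0n mulr0 normr_le0 subr_eq0.
by move/eqP.
Qed.

Lemma diff_expmx A : differentiable (fun t : R => expmx (t *: A)) 0 /\
  'd (fun t : R => expmx (t *: A)) 0 1 = A.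
Proof.
pose f (t : R) := expmx (t *: A).
have [C C0 HC] := expmx_bound A.
have lim_f : h^-1 *: ((f \o shift 0) (h *: (1 : R)) - f 0) @[h --> 0^'] --> A.
  apply/cvgrPdist_le => e e0; near=> h.
  have h0 : h != 0 by near: h; exact: nbhs_dnbhs_neq.
  have h1 : `|h| <= 1 by near: h; apply: dnbhs0_le.
  (* [C] may be 0, hence the divisor [C + 1]. *)
  have hC : `|h| <= e / (C + 1) by near: h; apply: dnbhs0_le; rewrite divr_gt0// ltr_wpDl.
  rewrite /f /= addr0 [_ *: 1]mulr1 scale0r expmx0.
  have -> : A - h^-1 *: (expmx (h *: A) - 1%:M) =
    - (h^-1 *: (expmx (h *: A) - (1%:M + h *: A))).
    by rewrite [in RHS]opprD addrA [in RHS]scalerBr scalerA mulVf// scale1r opprB.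
  rewrite normrN normrZ normfV; have := HC h h1 => Hh.
  rewrite ler_pdivrMl ?normr_gt0//; apply: le_trans Hh _.
  rewrite -(real_normK (num_real h)) expr2 mulrCA ler_wpM2l//.
  rewrite -[leRHS](@divfK _ (C + 1)) ?gt_eqF ?ltr_wpDl//.
  by rewrite mulrC ler_pM// lerDl.
have df : derivable f 0 1 by apply/cvg_ex; exists A.
have Df : differentiable f 0 by apply/derivable1_diffP.
split=> //; rewrite -deriveE//; apply: cvg_lim => //.
Unshelve. all: by end_near. Qed.
End MatrixExponential.

(** * The frame bundle in charts *)

Section FrameCalculus.
Context {R : realType} {m : nat} {M : manifoldType 'cV[R]_m}.
Implicit Types (c : chart 'cV[R]_m M) (u v : frame M).
Local Notation EF := ('cV[R]_m * 'M[R]_m)%type.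

Lemma mapcolsM (L : {linear 'cV[R]_m -> 'cV[R]_m}) (A B : 'M[R]_m) :
  mapcols L (A *m B) = mapcols L A *m B.
Proof. by rewrite mapcols_mul [in RHS]mapcols_mul mulmxA. Qed.

Lemma frame_chart_atlas c (ac : atlas c) : @atlas R EF (frame M) (frame_chart ac).
Proof. by exists c, ac. Qed.

(** The right action does not move the base point, so a frame and its translates share their chosen
    chart, where the action is linear. *)
Lemma frame_chart_at_base u v : fbase u = fbase v ->
  chart_at u = chart_at v :> chart EF (frame M).
Proof. by move=> e; rewrite /chart_at /= /frame_chart_at e. Qed.

Lemma frame_act_fbase u A : fbase (frame_act u A) = fbase u.
Proof. exact: fbase_mk. Qed.

Lemma frame_act_fmx u A : A \in unitmx -> fmx (frame_act u A) = fmx u *m A.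
Proof. by move=> Au; rewrite fmx_mk// unitmx_mul fmx_unit. Qed.

Lemma frame_act1 u : frame_act u 1%:M = u.
Proof.
by apply: frame_inj; rewrite ?frame_act_fbase// frame_act_fmx ?unitmx1// mulmx1.
Qed.

Lemma frame_map_act c u A : A \in unitmx ->
  frame_map c (frame_act u A) = ((frame_map c u).1, (frame_map c u).2 *m A).
Proof.
move=> Au; rewrite /frame_map frame_act_fbase /=; congr (_, _).
by rewrite frame_act_fmx// mapcolsM.
Qed.

Lemma frame_map_fmx u : (frame_map (chart_at (fbase u)) u).2 = fmx u.
Proof.
rewrite /frame_map /= -[RHS]mapcols_id; apply: eq_mapcols => v.
exact: (congr1 (@^~ v) (tchange_id (chart_at_dom (fbase u)))).
Qed.

Lemma frame_map_unit c u : atlas c -> cdom c (fbase u) -> (frame_map c u).2 \in unitmx.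
Proof.
move=> ac cu; apply: mapcols_unit (fmx_unit u).
by apply: tchangeK => //; [exact: chart_at_atlas|exact: chart_at_dom].
Qed.

Lemma mdiff_fbase u : mderivable (@fbase R m M) u /\
  forall z, mdiff (@fbase R m M) u z = z.1.
Proof.
pose c : chart 'cV[R]_m M := chart_at (fbase u).
have H : \forall z \near cmap (chart_at u : chart EF (frame M)) u,
    fst z = (cmap c \o @fbase R m M \o cinv (chart_at u : chart EF (frame M))) z.
  have := near_cimg (chart_at_dom u : cdom (chart_at u : chart EF (frame M)) u).
  apply: filterS => z [v cv <-] /=.
  by rewrite frame_mapK//; exact: chart_at_atlas.
have cf : continuous (fst : EF -> 'cV[R]_m) by move=> z; exact: cvg_fst.
have df : differentiable (fst : EF -> 'cV[R]_m) (cmap (chart_at u : chart EF (frame M)) u).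
  exact: linear_differentiable.
have [D e] := near_eq_differentiable H df; split.
  by split; [exact: fbase_continuous|exact: D].
by move=> z; apply: etrans (congr1 (@^~ z) e) _; rewrite (diff_lin _ cf).
Qed.

Lemma mdiff_frame_act A u : A \in unitmx -> mderivable (frame_act ^~ A) u /\
  forall z, mdiff (frame_act ^~ A) u z = (z.1, z.2 *m A).
Proof.
move=> Au; pose c : chart 'cV[R]_m M := chart_at (fbase u).
pose fc : chart EF (frame M) := chart_at u.
pose L (z : EF) : EF := (z.1, z.2 *m A).
have linL : linear L.
  by move=> a z w; rewrite /L /= mulmxDl -scalemxAl.
pose LL : {linear EF -> EF} := HB.pack L (GRing.isLinear.Build _ _ _ _ _ linL).
have cL : continuous LL by exact: findim_linear_continuous.
have ac : atlas c by exact: chart_at_atlas.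
have H : \forall z \near cmap fc u, L z = (cmap fc \o frame_act ^~ A \o cinv fc) z.
  apply: filterS (near_cimg (chart_at_dom u : cdom fc u)) => z [v cv <-].
  by rewrite /= (frame_mapK ac cv) frame_map_act.
have dL : differentiable L (cmap fc u) by exact: (linear_differentiable _ cL).
have [D e] := near_eq_differentiable H dL.
have ch : chart_at (frame_act u A) = fc :> chart EF (frame M).
  by apply: frame_chart_at_base; rewrite frame_act_fbase.
split; last first.
  move=> z; rewrite /mdiff ch; apply: etrans (congr1 (@^~ z) e) _.
  by rewrite (diff_lin (f := LL) _ cL).
apply: (@mderivable_local _ _ _ _ _ _ u fc fc);
  [exact: chart_at_atlas|exact: chart_at_atlas|exact: chart_at_dom| |exact: D].
apply: filterS (near_cdom (chart_at_dom u : cdom fc u)) => v.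
by rewrite /fc /= /frame_dom /= frame_act_fbase.
Qed.

Lemma frame_curve_velocity c (ac : atlas c) u (f : R -> 'M[R]_m) A : cdom c (fbase u) ->
  differentiable f 0 -> f 0 = 1%:M -> 'd f 0 1 = A ->
  tchange (chart_at u) (frame_chart ac) u (velocity (fun t => frame_act u (f t)) 0) =
  (0, (frame_map c u).2 *m A).
Proof.
move=> cu df f0 fA; pose gamma t := frame_act u (f t).
have g0 : gamma 0 = u by rewrite /gamma f0 frame_act1.
pose e := (frame_map c u).2.
pose H (t : R) : EF := (cmap c (fbase u), e *m f t).
(* For singular [f t] the frame is the default of [mkframe]; invertibility near 0 makes the
   coordinate formula valid. *)
have unear : \forall t \near (0 : R), f t \in unitmx.
  have : nbhs (f 0) [set B : 'M[R]_m | B \in unitmx].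
    apply: open_nbhs_nbhs; split; first exact: open_unitmx.
    by rewrite /= f0 unitmx1.
  exact: (differentiable_continuous df).
have cl : continuous (mulmx e : {linear 'M[R]_m -> 'M[R]_m}).
  exact: findim_linear_continuous.
have dl : differentiable (mulmx e) (f 0) by exact: (linear_differentiable _ cl).
have dm := differentiable_comp df dl.
have dH : differentiable H 0 by exact: (differentiable_pair (differentiable_cst _ _) dm).
have He : 'd H 0 1 = (0, e *m A).
  have h1 := diff_pair (differentiable_cst (cmap c (fbase u)) (0 : R)) dm.
  apply: etrans (congr1 (@^~ 1) h1) _; rewrite /= diff_cst; congr (_, _).
  apply: etrans (congr1 (@^~ 1) (diff_comp df dl)) _.
  by rewrite /= (diff_lin _ cl) fA.
have nH : \forall t \near (0 : R), H t = (cmap (frame_chart ac) \o gamma) t.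
  by apply: filterS unear => t ut; rewrite /= /gamma frame_map_act.
have [D De] := near_eq_differentiable nH dH.
have nd : \forall t \near (0 : R), cdom (frame_chart ac) (gamma t).
  by apply: filterS unear => t _; rewrite /= /frame_dom /= frame_act_fbase.
have := velocity_chart (frame_chart_atlas ac) nd D; rewrite g0 => ->.
have -> : derive1 (cmap (frame_chart ac) \o gamma) 0 = 'd (cmap (frame_chart ac) \o gamma) 0 1.
  exact: derive1E'.
by rewrite De He.
Qed.

Lemma transversal_velocity c (ac : atlas c) u mu : cdom c (fbase u) ->
  tchange (chart_at u) (frame_chart ac) u
    (velocity (fun t : R => frame_act u (expmx (t *: mu))) 0) =
  (0, (frame_map c u).2 *m mu).
Proof.
move=> cu; have [D e] := diff_expmx mu.
by apply: (frame_curve_velocity ac cu D) => //; rewrite scale0r expmx0.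
Qed.

Lemma velocity_expmx u mu :
  velocity (fun t : R => frame_act u (expmx (t *: mu))) 0 = (0, fmx u *m mu).
Proof.
have ac := chart_at_atlas (fbase u); have cu := chart_at_dom (fbase u).
have := transversal_velocity ac mu cu; rewrite frame_map_fmx => <-.
exact: (esym (congr1 (@^~ _) (tchange_id (chart_at_dom u)))).
Qed.

(** Replaces the exponential curves by a linear image of [mm], on which linear algebra can be
    done. *)
Lemma transversalE (mm : {vspace 'M[R]_m}) u : Defs.transversal mm u =
  [set (0, fmx u *m mu) | mu in [set mu | mu \in mm]].
Proof.
by apply/seteqP; split=> z /= [mu mmu <-]; exists mu; rewrite ?velocity_expmx.
Qed.
End FrameCalculus.

Section FrameOrbit.
Context {R : realType} {m : nat} {M : manifoldType 'cV[R]_m}.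
Context {F : normedModType R} {N : manifoldType F}.
Local Notation EF := ('cV[R]_m * 'M[R]_m)%type.

Lemma mdiff_frame_orbit (f : N -> 'M[R]_m) b (u : frame M) : mderivable f b ->
  (forall a, f a \in unitmx) -> mderivable (fun a => frame_act u (f a)) b /\
  forall tau, mdiff (fun a => frame_act u (f a)) b tau = (0, fmx u *m mdiff f b tau).
Proof.
move=> [cf df] fu; pose c : chart 'cV[R]_m M := chart_at (fbase u).
pose fc : chart EF (frame M) := chart_at u.
pose d : chart F N := chart_at b.
pose H (y : F) : EF := (cmap c (fbase u), fmx u *m f (cinv d y)).
have df' : differentiable (fun y => f (cinv d y)) (cmap d b) by exact: df.
have cl : continuous (mulmx (fmx u) : {linear 'M[R]_m -> 'M[R]_m}).
  exact: findim_linear_continuous.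
have dl : differentiable (mulmx (fmx u)) (f (cinv d (cmap d b))).
  by exact: (linear_differentiable _ cl).
have dm := differentiable_comp df' dl.
have dc := differentiable_cst (cmap c (fbase u)) (cmap d b).
have dH : differentiable H (cmap d b) by exact: (differentiable_pair dc dm).
have e a : cmap fc (frame_act u (f a)) = (cmap c (fbase u), fmx u *m f a).
  by rewrite /fc /= frame_map_act// frame_map_fmx.
have HE : H = cmap fc \o (fun a => frame_act u (f a)) \o cinv d.
  by apply/funext => y; rewrite /H /= -e.
have ch : chart_at (frame_act u (f b)) = fc :> chart EF (frame M).
  by apply: frame_chart_at_base; rewrite frame_act_fbase.
split=> [|tau].
  apply: (@mderivable_local _ _ _ _ _ _ b d fc);
    [exact: chart_at_atlas|exact: chart_at_atlas|exact: chart_at_dom| |by rewrite -HE].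
  apply: filterS (near_cdom (chart_at_dom b : cdom d b)) => a _.
  by rewrite /fc /= /frame_dom /= frame_act_fbase; exact: chart_at_dom.
rewrite /mdiff ch -HE; apply: etrans (congr1 (@^~ tau) (diff_pair dc dm)) _.
rewrite /= diff_cst; congr (_, _).
apply: etrans (congr1 (@^~ tau) (diff_comp df' dl)) _.
by rewrite /= (diff_lin _ cl).
Qed.
End FrameOrbit.

(** * The natural lift in frame charts *)

Section NaturalLift.
Context {R : realType} {m : nat} {M : manifoldType 'cV[R]_m}.
Implicit Types (c : chart 'cV[R]_m M) (u v : frame M).
Local Notation EF := ('cV[R]_m * 'M[R]_m)%type.
Local Notation TY := (R^o * 'cV[R]_m)%type.

(** The Jacobian in the space variables only, time being the first component of [z]. *)
Definition jacobian (Phi : TY -> 'cV[R]_m) (z : TY) : 'M[R]_m :=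
  \matrix_(i, l) 'D_((0 : R^o, delta_mx l 0 : 'cV[R]_m)) Phi z i 0.

(** Invertibility of [N] ensures that the lifted matrix is a frame and not the default of
    [mkframe]. *)
Lemma frame_lift_chart c (phi : M -> M) u : atlas c -> cdom c (fbase u) ->
  mderivable phi (fbase u) -> cdom c (phi (fbase u)) ->
  let N := mapcols ('d (cmap c \o phi \o cinv c) (cmap c (fbase u))) 1%:M in
  N \in unitmx ->
  frame_map c (frame_lift phi u) = (cmap c (phi (fbase u)), N *m (frame_map c u).2).
Proof.
move=> ac cu dphi cphi N Nu.
have [_ e] := mderivable_chart dphi ac ac cu cphi.
have uu := frame_map_unit ac cu.
have aphi := chart_at_atlas (phi (fbase u)); have dphix := chart_at_dom (phi (fbase u)).
pose f := mapcols (mdiff phi (fbase u)) (fmx u).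
have Ef : mapcols (tchange (chart_at (phi (fbase u))) c (phi (fbase u))) f =
    N *m (frame_map c u).2.
  rewrite /f mapcols_comp /N -mapcols_mul /frame_map /= mapcols_comp.
  by apply: eq_mapcols => v; exact: (esym (e v)).
have fu : f \in unitmx.
  have : mapcols (tchange c (chart_at (phi (fbase u))) (phi (fbase u)))
      (N *m (frame_map c u).2) \in unitmx.
    apply: mapcols_unit; last by rewrite unitmx_mul Nu.
    exact: tchangeK.
  suff -> : mapcols (tchange c (chart_at (phi (fbase u))) (phi (fbase u)))
      (N *m (frame_map c u).2) = f by [].
  rewrite -Ef mapcols_comp -[RHS]mapcols_id; apply: eq_mapcols => v.
  exact: tchangeK.
by rewrite /frame_map /frame_lift fbase_mk fmx_mk// -Ef.
Qed.

Lemma frame_lift_id u : frame_lift id u = u.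
Proof.
have e : mapcols (mdiff id (fbase u)) (fmx u) = fmx u.
  by rewrite -[RHS]mapcols_id; apply: eq_mapcols => v; rewrite (mdiff_id _).2.
by apply: frame_inj; rewrite ?fbase_mk ?e ?fmx_mk ?e// fmx_unit.
Qed.

Lemma velocity_cst (N : normedModType R) (L : manifoldType N) (x : L) t :
  velocity (fun=> x) t = 0.
Proof. exact: derive1_cst. Qed.

(* No existence theorem for flows is needed: if X had no flow, flow X would be the default
   value and natural_lift would vanish. The coefficients a and B are not identified, since
   only their smoothness and their independence of the frame matter. *)
Lemma natural_lift_chart (X : M -> 'cV[R]_m) c (ac : atlas c) :
  exists (a : 'cV[R]_m -> 'cV[R]_m) (B : 'cV[R]_m -> 'M[R]_m),
  [/\ smooth_on (cmap c @` cdom c) a, smooth_on (cmap c @` cdom c) B &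
    forall u, cdom c (fbase u) ->
    tchange (chart_at u) (frame_chart ac) u (natural_lift X u) =
    (a (cmap c (fbase u)), B (cmap c (fbase u)) *m (frame_map c u).2)].
Proof.
have [[phi0 flow0]|noflow] := pselect (exists phi, is_flow X phi); last first.
  have flowE : flow X = fun _ x => x.
    by apply: xgetPN => phi fphi; apply: noflow; exists phi.
  exists (fun=> 0), (fun=> 0); split=> [k|k|u cu]; [exact: Ck_cst|exact: Ck_cst|].
  rewrite mul0mx /natural_lift flowE.
  have -> : (fun _ : R => frame_lift id u) = fun=> u by rewrite frame_lift_id.
  by rewrite velocity_cst linear0.
have [D [oD D0 _ sphi [phi_0 _]]] : is_flow X (flow X).
  by apply: (@xgetPex _ _ [set phi | is_flow X phi]); exists phi0.
set phi := flow X in sphi phi_0.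
pose Phi (z : TY) := cmap c (phi z.1 (cinv c z.2)).
have loc x : cdom c x -> exists W : set TY, [/\ open W, W (0, cmap c x),
    (forall z, W z -> (cmap c @` cdom c) z.2), (forall z, W z -> cdom c (phi z.1 (cinv c z.2))) &
    smooth_on W Phi].
  move=> cx; pose c' := prod_chart (id_chart R^o) c.
  have ac' : @atlas _ _ (R^o * M)%type c' by exists (id_chart R^o, c).
  have c'x : cdom c' (0, x) by split.
  have cphi : cdom c (phi 0 x) by rewrite phi_0.
  have [W [oW Wx Wc Wd sW]] := msmooth_at_chart (sphi (0, x) (D0 x)) ac' ac c'x cphi.
  by exists W; split=> // z /Wc[[t y] [_ cy] <-]; exists y.
pose N := jacobian Phi.
have sN W : open W -> smooth_on W Phi -> smooth_on W N.
  move=> oW sW k; apply/(Ck_entries _ _ oW) => i l.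
  under eq_fun do rewrite mxE.
  have := (sW k.+1).2 (0, delta_mx l 0) => /(Ck_entries _ _ oW)/(_ i 0).
  exact.
pose tm : TY := (1, 0).
(* The domains [W] from [loc] depend on the point; [Ck_local] glues the slices at time 0. *)
have cut (G : normedModType R) (f : TY -> G) : findim G ->
    (forall W, open W -> smooth_on W Phi -> smooth_on W f) ->
    smooth_on (cmap c @` cdom c) (fun y => 'D_tm f (0, y)).
  move=> fG sf k; apply: Ck_local => _ [x cx <-].
  have [W [oW Wx _ _ sW]] := loc x cx.
  have ci k' : Ck k' setT (fun y : 'cV[R]_m => (0 : R^o, y) : TY).
    by apply: Ck_pair; [exact: openT|exact: Ck_cst|exact: Ck_id].
  have oW' : open (setT `&` (fun y : 'cV[R]_m => (0 : R^o, y) : TY) @^-1` W).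
    by apply: open_preimage_in => //; [exact: openT|exact: (ci 0)].
  exists (setT `&` (fun y : 'cV[R]_m => (0 : R^o, y) : TY) @^-1` W); first by split.
  apply: (@Ck_comp _ _ _ _ _ _ W (fun y => (0 : R^o, y) : TY) (fun z => 'D_tm f z) _ _ oW').
  - by move=> y [].
  - exact: Ck_subset (ci k).
  - exact: ((sf W oW sW k.+1).2 tm).
(* In the frame chart the lifted flow is [(Phi (t, y), N (t, y) *m e)]; these are its time
   derivatives at 0, the second before multiplication by [e]. *)
exists (fun y => 'D_tm Phi (0, y)), (fun y => 'D_tm N (0, y)); split.
- exact: cut.
- exact: cut.
move=> u cu; pose x := fbase u; pose y := cmap c x; pose e := (frame_map c u).2.
have [W [oW Wx Wc Wd sW]] := loc x cu.
have dPhi z : W z -> differentiable Phi z by exact: (sW 1%N).1.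
have dN z : W z -> differentiable N z by exact: (sN W oW sW 1%N).1.
have dcurve : differentiable (fun t : R => (t : R^o, y) : TY) 0.
  have di : differentiable (@id R^o) 0 by exact: ex_diff.
  exact: (differentiable_pair di (differentiable_cst y (0 : R))).
have curveW : \forall t \near (0 : R), W (t, y).
  have : nbhs ((0 : R^o, y) : TY) W by exact: open_nbhs_nbhs.
  exact: (differentiable_continuous dcurve).
have sliceW t : W (t, y) -> \forall y' \near y, W (t, y').
  move=> Wt.
  have di : differentiable (@id 'cV[R]_m) y by exact: ex_diff.
  have d1 := differentiable_pair (differentiable_cst (t : R^o) y) di.
  have : nbhs ((t : R^o, y) : TY) W by exact: open_nbhs_nbhs.
  exact: (differentiable_continuous d1).
have dslice t : W (t, y) -> differentiable (cmap c \o phi t \o cinv c) y /\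
    forall v : 'cV[R]_m, 'd (cmap c \o phi t \o cinv c) y v = 'D_((0 : R^o, v)) Phi (t, y).
  move=> Wt; have dc := differentiable_cst (t : R^o) y.
  have di : differentiable (@id 'cV[R]_m) y by exact: ex_diff.
  have d1 := differentiable_pair dc di.
  have d2 := dPhi _ Wt; split; first exact: (differentiable_comp d1 d2).
  move=> v; apply: etrans (congr1 (@^~ v) (diff_comp d1 d2)) _.
  rewrite deriveE//=; congr ('d Phi _ _).
  apply: etrans (congr1 (@^~ v) (diff_pair dc di)) _; rewrite /= diff_cst.
  have ci : continuous (@idfun 'cV[R]_m) by move=> z; exact: cvg_id.
  by congr (_, _); exact: (congr1 (@^~ v) (@diff_lin _ _ _ idfun y ci)).
have NE t : W (t, y) -> mapcols ('d (cmap c \o phi t \o cinv c) y) 1%:M = N (t, y).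
  move=> /dslice[_ e1]; apply/matrixP => i l; rewrite [LHS]mxE [RHS]mxE e1.
  suff -> : col l (1%:M : 'M[R]_m) = delta_mx l 0 by [].
  by apply/matrixP => r s; rewrite !mxE ord1 eqxx andbT.
have N0 : N (0, y) = 1%:M.
  rewrite -NE// -[RHS]mapcols_id; apply: eq_mapcols => v.
  have -> : phi 0 = id by apply/funext => z; exact: phi_0.
  exact: (congr1 (@^~ v) (tchange_id cu)).
have ecurve : 'd (fun t : R => (t : R^o, y) : TY) 0 1 = tm.
  have di : differentiable (@id R^o) 0 by exact: ex_diff.
  apply: etrans (congr1 (@^~ 1) (diff_pair di (differentiable_cst y (0 : R)))) _.
  rewrite /= diff_cst; congr (_, _).
  have ci : continuous (@idfun R^o) by move=> z; exact: cvg_id.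
  exact: (congr1 (@^~ 1) (@diff_lin _ _ _ idfun (0 : R^o) ci)).
have unear : \forall t \near (0 : R), N (t, y) \in unitmx.
  have : nbhs (N (0, y)) [set B : 'M[R]_m | B \in unitmx].
    apply: open_nbhs_nbhs; split; first exact: open_unitmx.
    by rewrite /= N0 unitmx1.
  have dNc := differentiable_comp dcurve (dN _ Wx).
  exact: (differentiable_continuous dNc).
pose gamma t := frame_lift (phi t) u.
have g0 : gamma 0 = u.
  rewrite /gamma; have -> : phi 0 = id by apply/funext => z; exact: phi_0.
  exact: frame_lift_id.
pose H (z : TY) : EF := (Phi z, N z *m e).
have gH : \forall t \near (0 : R), H (t, y) = (cmap (frame_chart ac) \o gamma) t.
  apply: filterS2 curveW unear => t Wt Nt.
  have cphit : cdom c (phi t x) by have := Wd _ Wt; rewrite /= /y cmapK.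
  have dphi : mderivable (phi t) x.
    apply: (mderivable_local ac ac cu); last exact: (dslice _ Wt).1.
    apply: filterS2 (near_cdom cu) (near_cmap cu (sliceW _ Wt)) => x' cx' /Wd.
    by rewrite /= cmapK.
  rewrite /= frame_lift_chart//; last by rewrite NE.
  by rewrite NE// /H /Phi /= /y cmapK.
have cl : continuous (mulmxr e : {linear 'M[R]_m -> 'M[R]_m}).
  exact: findim_linear_continuous.
have dl : differentiable (mulmxr e) (N (0, y)) by exact: (linear_differentiable _ cl).
have dNe := differentiable_comp (dN _ Wx) dl.
have dH : differentiable H (0, y) by exact: (differentiable_pair (dPhi _ Wx) dNe).
have dHc := differentiable_comp dcurve dH.
have [Dg eg] := near_eq_differentiable gH dHc.
have nd : \forall t \near (0 : R), cdom (frame_chart ac) (gamma t).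
  apply: filterS curveW => t /Wd.
  by rewrite /= /frame_dom /= /gamma /frame_lift fbase_mk /y cmapK.
have := velocity_chart (frame_chart_atlas ac) nd Dg; rewrite g0 => ->.
have -> : derive1 (cmap (frame_chart ac) \o gamma) 0 = 'd (cmap (frame_chart ac) \o gamma) 0 1.
  exact: derive1E'.
rewrite eg; apply: etrans (congr1 (@^~ 1) (diff_comp dcurve dH)) _.
rewrite [LHS]/= ecurve; apply: etrans (congr1 (@^~ tm) (diff_pair (dPhi _ Wx) dNe)) _.
rewrite [LHS]/= (deriveE _ (dPhi _ Wx)) (deriveE _ (dN _ Wx)); congr (_, _).
apply: etrans (congr1 (@^~ tm) (diff_comp (dN _ Wx) dl)) _.
by rewrite /= (diff_lin _ cl).
Qed.
End NaturalLift.

(** * The Kosmann lift *)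

Lemma Ck_solve_lin (R : realType) (E F : normedModType R) {fF : findim F} k (U : set E) q
    (L : E -> {linear 'cV[R]_q -> F}) (b : E -> F) (x : E -> 'cV[R]_q) : open U ->
  (forall l, Ck k U (fun y => L y (delta_mx l 0))) -> Ck k U b ->
  (forall y, U y -> forall v, L y v = 0 -> v = 0) ->
  (forall y, U y -> L y (x y) = b y) -> Ck k U x.
Proof.
move=> oU cL cb Linj Lx; have [N [phi [e [cphi De]]]] := fF.
pose A y := \matrix_(i < N, l < q) (phi i (L y (delta_mx l 0)) : R).
have AE y v : A y *m v = \col_i (phi i (L y v) : R).
  apply/matrixP => i r; rewrite ord1 !mxE.
  rewrite [in RHS](matrix_sum_delta v) !linear_sum; apply: eq_bigr => l _.
  by rewrite big_ord1 !linearZ mxE mulrC.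
apply: (Ck_solve (A := A) (b := fun y => \col_i (phi i (b y) : R)) oU).
- apply/(Ck_entries _ _ oU) => i l; under eq_fun do rewrite mxE.
  exact: (Ck_compl oU (cphi i) (cL l)).
- apply/(Ck_entries _ _ oU) => i l; under eq_fun do rewrite mxE.
  exact: (Ck_compl oU (cphi i) cb).
- move=> y Uy v; rewrite AE => /matrixP v0; apply: (Linj y Uy).
  rewrite (De (L y v)) big1// => i _.
  by have := v0 i 0; rewrite !mxE => ->; rewrite scale0r.
- by move=> y Uy; rewrite AE Lx.
Qed.

Lemma mdiff_chart_tangent (R : realType) (E F : normedModType R) (M : manifoldType E)
    (N : manifoldType F) (f : M -> N) x (c : chart E M) (d : chart F N) : mderivable f x ->
  atlas c -> atlas d -> cdom c x -> cdom d (f x) -> forall v,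
  'd (cmap d \o f \o cinv c) (cmap c x) v =
  tchange (chart_at (f x)) d (f x) (mdiff f x (tchange c (chart_at x) x v)).
Proof.
move=> df ac ad cx dx v; have [_ <-] := mderivable_chart df ac ad cx dx.
by congr ('d _ _ _); apply/esym; apply: tchangeK; [|exact: chart_at_atlas| |exact: chart_at_dom].
Qed.

Lemma tchange_eq0 (R : realType) (E : normedModType R) (M : manifoldType E)
    (c d : chart E M) x v : atlas c -> atlas d -> cdom c x -> cdom d x ->
  tchange c d x v = 0 -> v = 0.
Proof.
move=> ac ad cx dx v0.
exact: etrans (esym (tchangeK ac ad cx dx v)) (etrans (congr1 _ v0) (linear0 _)).
Qed.

Section KosmannLift.
Context {R : realType} {m k p : nat} {M : manifoldType 'cV[R]_m}.
Context {G : lieGroupType 'cV[R]_k} {P : manifoldType 'cV[R]_p}.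
Context (j : G -> 'M[R]_m) (mm : {vspace 'M[R]_m})
  (pi : P -> M) (act : P -> G -> P) (i : P -> frame M).
Context (cG : classical_G_structure j mm pi act i) (X : M -> 'cV[R]_m).
Local Notation EF := ('cV[R]_m * 'M[R]_m)%type.
Local Notation K := (kosmann_lift mm i X).

Let B : principal_bundle pi act. Proof. by case: cG. Qed.

Let di u : mderivable i u.
Proof. by have [_ _ [/(_ u)/msmooth_at_mderivable]] := cG. Qed.

Let dj a : mderivable j a.
Proof. by have [[[/(_ a)/msmooth_at_mderivable]]] := cG. Qed.

Let ju a : j a \in unitmx.
Proof. by have [[[_ /(_ a)]]] := cG. Qed.

Let pair_sum (a : 'cV[R]_m) (b c : 'M[R]_m) : (a, b) + (0, c) = (a, b + c) :> EF.
Proof. by rewrite -[LHS]/(a + 0, b + c) addr0. Qed.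

Let mdiff_i_base u v : (mdiff i u v).1 = mdiff pi u v.
Proof.
have [_ _ _ ibase _] := cG; have [df ef] := mdiff_fbase (i u).
have [_ e] := mdiff_comp (di u) df.
have fi : @fbase R m M \o i = pi by apply/funext => x; exact: ibase.
apply: etrans (esym (ef _)) _; apply: etrans (esym (e v)) _.
exact: (congr1 (fun f : P -> M => mdiff f u v) fi).
Qed.

Let mdiff_i_orbit u tau : mdiff i u (mdiff (act u) 1%g tau) =
  (0, fmx (i u) *m mdiff j 1%g tau).
Proof.
have [_ _ _ _ iact] := cG; have [_ _ [act1 _] _ _] := B.
have [_ e] := mdiff_comp (bundle_orbit_mderivable B u 1%g) (di _).
have := e tau; rewrite act1 => <-.
have -> : i \o act u = fun a => frame_act (i u) (j a).
  by apply/funext => a; exact: iact.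
exact: (mdiff_frame_orbit (i u) (dj 1%g) ju).2.
Qed.

Let lie_algebraP h : reflect (exists tau, h = mdiff j 1%g tau) (h \in lie_algebra j).
Proof.
apply: (iffP memv_imgP) => [[tau _ ->]|[tau ->]].
  by exists tau; rewrite /mdiff lfunE.
by exists tau; rewrite ?memvf// /mdiff lfunE.
Qed.

(** The [mm]-part has no base component, so [v] is vertical and comes from the Lie algebra;
    cancelling the invertible frame leaves an element of [lie_algebra j :&: mm]. *)
Lemma kosmann_split_inj u v mu : mu \in mm ->
  mdiff i u v + (0, fmx (i u) *m mu) = 0 -> v = 0 /\ mu = 0.
Proof.
move=> mmu e0; have [[_ [_ dir _]] _ [_ _ iimm] _ _] := cG.
have v1 : (mdiff i u v).1 = 0 by have := congr1 fst e0; rewrite /= addr0.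
have [tau vt] : exists tau, v = mdiff (act u) 1%g tau.
  by apply: (mdiff_vertical B); rewrite -mdiff_i_base.
move: e0; rewrite {1}vt mdiff_i_orbit pair_sum -mulmxDr => /(congr1 snd) /= e0.
have hm : mdiff j 1%g tau + mu = 0.
  by rewrite -(mulKmx (fmx_unit (i u)) (_ + mu)) e0 mulmx0.
have hmm : mdiff j 1%g tau \in mm.
  by rewrite (_ : mdiff j 1%g tau = - mu) ?memvN//; apply/eqP; rewrite -addr_eq0 hm.
have : mdiff j 1%g tau \in (lie_algebra j :&: mm)%VS.
  by rewrite memv_cap hmm andbT; apply/lie_algebraP; exists tau.
rewrite dir memv0 => /eqP h0; move: hm; rewrite h0 add0r => mu0; split=> //.
by apply: (iimm u); rewrite mdiff0 vt mdiff_i_orbit h0 mulmx0.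
Qed.

(** Lift the base component to [v0]; the matrix that remains, read in the frame [i u], splits along
    the Lie algebra and [mm]. *)
Lemma kosmann_split_surj u (z : EF) : exists v (mu : 'M[R]_m), mu \in mm /\
  z = mdiff i u v + (0, fmx (i u) *m mu).
Proof.
have [[_ [full _ _]] _ _ _ _] := cG.
have [v0 v0P] := mdiff_proj_surj B u z.1.
pose C := invmx (fmx (i u)) *m (z.2 - (mdiff i u v0).2).
have /memv_addP[h /lie_algebraP[tau ->] [mu mmu Ce]] : C \in (lie_algebra j + mm)%VS.
  by rewrite full memvf.
exists (v0 + mdiff (act u) 1%g tau), mu; split=> //.
rewrite mdiffD mdiff_i_orbit -addrA pair_sum -mulmxDr -Ce /C mulKVmx ?fmx_unit//.
rewrite [LHS]surjective_pairing [mdiff i u v0]surjective_pairing mdiff_i_base v0P.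
by rewrite -[RHS]/(_ + 0, _ + _) addr0 addrC subrK.
Qed.

(** Existence of the splitting ensures that [xget] returns a solution and not its default 0. *)
Lemma kosmann_liftP u : exists2 mu, mu \in mm &
  natural_lift X (i u) = mdiff i u (K u) + (0, fmx (i u) *m mu).
Proof.
have [v [mu [mmu e]]] := kosmann_split_surj u (natural_lift X (i u)).
have : exists v, [set v | exists2 w, Defs.transversal mm (i u) w &
    natural_lift X (i u) = mdiff i u v + w] v.
  by exists v, (0, fmx (i u) *m mu) => //; rewrite transversalE; exists mu.
move=> /(xgetPex 0)[w tw e']; move: tw; rewrite transversalE => -[mu' mmu' wE].
rewrite -wE in e'.
exists mu'; [exact: mmu'|exact: e'].
Qed.

Lemma kosmann_lift_unique u v mu : mu \in mm ->
  natural_lift X (i u) = mdiff i u v + (0, fmx (i u) *m mu) -> v = K u.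
Proof.
move=> mmu e; have [mu' mmu' e'] := kosmann_liftP u.
have [|/eqP] := @kosmann_split_inj u (v - K u) (mu - mu') (rpredB mmu mmu').
  rewrite mdiffB mulmxBr.
  have -> : (0, fmx (i u) *m mu - fmx (i u) *m mu') =
     (0, fmx (i u) *m mu) - (0, fmx (i u) *m mu') :> EF.
    by rewrite -[RHS]/(0 - 0, _ - _) subr0.
  by rewrite addrACA -opprD -e -e' subrr.
by rewrite subr_eq0 => /eqP.
Qed.

(** In a frame chart the lift is [(a y, B y *m e)]: left multiplication by [B y] commutes with the
    right action on [e]. *)
Lemma natural_lift_act w A : A \in unitmx ->
  natural_lift X (frame_act w A) = ((natural_lift X w).1, (natural_lift X w).2 *m A).
Proof.
move=> Au; pose ac := chart_at_atlas (fbase w); have cw := chart_at_dom (fbase w).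
have [a [b [_ _ ab]]] := natural_lift_chart X ac.
have E v : fbase v = fbase w ->
    natural_lift X v = (a (cmap (chart_at (fbase w)) (fbase w)),
      b (cmap (chart_at (fbase w)) (fbase w)) *m fmx v).
  move=> vw; have := ab v; rewrite vw => /(_ cw).
  rewrite -[in (frame_map _ v)]vw frame_map_fmx => <-.
  have <- : chart_at v = frame_chart ac :> chart EF (frame M).
    exact: (frame_chart_at_base vw).
  exact: (esym (congr1 (@^~ _) (tchange_id (chart_at_dom v)))).
rewrite E ?frame_act_fbase// E// frame_act_fmx//=.
by rewrite mulmxA.
Qed.

Lemma kosmann_lift_invariant : invariant_vf act K.
Proof.
move=> a u; have [[_ [_ _ Ad]] _ _ _ iact] := cG.
have [[[_ _ jM _ _] _] _ _ _ _] := cG.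
have [mu mmu e] := kosmann_liftP u.
(* Moving [j a] to the left of [mu] conjugates it by the inverse, so Ad-invariance is used at
   [a^-1]. *)
have mmu' : invmx (j a) *m mu *m j a \in mm.
  have j1 : j 1%g = 1%:M.
    have := jM 1%g 1%g; rewrite mulg1 => /(congr1 (mulmx (invmx (j 1%g)))).
    by rewrite mulKmx// mulVmx.
  have jV : j a^-1%g = invmx (j a).
    by rewrite -[LHS](mulmxK (ju a)) -jM mulVg j1 mul1mx.
  by have := Ad a^-1%g _ mmu; rewrite jV invmxK.
apply: (kosmann_lift_unique mmu').
have [_ e1] := mdiff_comp (bundle_translation_mderivable B a u) (di _).
rewrite -e1; have -> : i \o act ^~ a = (frame_act ^~ (j a)) \o i.
  by apply/funext => v; exact: iact.
have [da ea] := mdiff_frame_act (i u) (ju a).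
have [_ ->] := mdiff_comp (di u) da.
rewrite iact natural_lift_act// e ea frame_act_fmx// !mulmxA mulmxK//.
by rewrite [mdiff i u (K u)]surjective_pairing pair_sum /= pair_sum mulmxDl.
Qed.

(* In charts, xi_K and the coordinates of the m-component solve an injective linear
   system with smooth coefficients. *)
Lemma kosmann_lift_smooth : smooth_vf K.
Proof.
have [_ _ [si _ _] ibase _] := cG.
move=> c ac r; apply: Ck_local => _ [u cu <-].
pose d : chart 'cV[R]_m M := chart_at (pi u).
have ad : atlas d by exact: chart_at_atlas.
pose fd := frame_chart ad.
have afd : atlas fd by exact: frame_chart_atlas.
have fdu : cdom fd (i u) by rewrite /fd /= /frame_dom /= ibase; exact: chart_at_dom.
have [W [oW Wu Wc Wd sW]] := msmooth_at_chart (si u) ac afd cu fdu.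
exists W => //; pose I : 'cV[R]_p -> EF := cmap fd \o i \o cinv c.
have {}sW : smooth_on W I by exact: sW.
have [a [b [sa sb ab]]] := natural_lift_chart X ad.
pose bas := vbasis mm.
pose mu_of (s : 'cV[R]_(\dim mm)) := \sum_l s l 0 *: bas`_l.
have mu_mm s : mu_of s \in mm.
  by apply: memv_suml => l _; apply/memvZ/vbasis_mem; rewrite mem_nth// size_tuple.
have mu_inj s : mu_of s = 0 -> s = 0.
  move=> s0; apply/matrixP => l l'; rewrite ord1 mxE.
  have fr : free bas by apply: basis_free; exact: vbasisP.
  have := coord_sum_free (fun l => s l 0) l fr; rewrite -/(mu_of s) s0 linear0.
  by [].
(* The unknown stacks the coordinates of the lift and those of the [mm]-component in a basis of
   [mm]. *)
pose L y (v : 'cV[R]_(p + \dim mm)) : EF :=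
  'd I y (usubmx v) + (0, (I y).2 *m mu_of (dsubmx v)).
have mu_lin : linear mu_of.
  move=> x v w; rewrite /mu_of scaler_sumr -big_split /=; apply: eq_bigr => l _.
  by rewrite !mxE scalerDl scalerA.
have linL y : linear (L y).
  move=> x v w; rewrite /L !linearP mu_lin mulmxDr -scalemxAr.
  have -> : (0, x *: ((I y).2 *m mu_of (dsubmx v)) + (I y).2 *m mu_of (dsubmx w)) =
     x *: (0, (I y).2 *m mu_of (dsubmx v)) + (0, (I y).2 *m mu_of (dsubmx w)) :> EF.
    by rewrite -[RHS]/(x *: 0 + 0, _) scaler0 addr0.
  by rewrite scalerDr addrACA.
pose LL y : {linear 'cV[R]_(p + \dim mm) -> EF} :=
  HB.pack (L y) (GRing.isLinear.Build _ _ _ _ _ (linL y)).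
have frameW y : W y -> exists w, [/\ y = cmap c w, cdom c w & cdom fd (i w)].
  move=> Wy; have [w cw wy] := Wc _ Wy; exists w; split=> //.
  by have := Wd _ Wy; rewrite -wy cmapK.
have dIE y w v : y = cmap c w -> cdom c w -> cdom fd (i w) ->
    'd I y v = tchange (chart_at (i w)) fd (i w) (mdiff i w (tchange c (chart_at w) w v)).
  by move=> -> cw fw; exact: (mdiff_chart_tangent (di w) ac afd cw fw).
have muE w mu : cdom fd (i w) ->
    tchange (chart_at (i w)) fd (i w) (0, fmx (i w) *m mu) = (0, (cmap fd (i w)).2 *m mu).
  by move=> fw; rewrite -velocity_expmx; exact: transversal_velocity.
have tinj w z : cdom fd (i w) -> tchange (chart_at (i w)) fd (i w) z = 0 -> z = 0.
  by move=> fw; exact: (tchange_eq0 (chart_at_atlas (i w)) afd (chart_at_dom (i w)) fw).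
have Linj y : W y -> forall v, LL y v = 0 -> v = 0.
  move=> /frameW[w [yw cw fw]] v; rewrite -[LL y v]/(L y v) /L (dIE _ _ _ yw cw fw).
  have Iy : I y = cmap fd (i w) by rewrite /I /= yw cmapK.
  rewrite Iy -muE// -linearD => /(tinj _ _ fw).
  move=> /(kosmann_split_inj (mu_mm _))[v0 /mu_inj v1].
  rewrite -(vsubmxK v) v1.
  have -> : usubmx v = 0; last by rewrite col_mx0.
  exact: (tchange_eq0 ac (chart_at_atlas w) cw (chart_at_dom w) v0).
have mu_ex w : exists s, natural_lift X (i w) =
    mdiff i w (K w) + (0, fmx (i w) *m mu_of s).
  have [mu mmu ->] := kosmann_liftP w.
  exists (\col_l coord bas l mu); congr (_ + (_, _ *m _)).
  rewrite {1}(coord_vbasis mmu) /mu_of; apply: eq_bigr => l _.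
  by rewrite mxE.
(* A bare pointwise choice; its smoothness results from [Ck_solve_lin] together with that of the
   lift. *)
pose s_of w := projT1 (cid (mu_ex w)).
have s_ofP w : natural_lift X (i w) = mdiff i w (K w) + (0, fmx (i w) *m mu_of (s_of w)).
  by rewrite /s_of; case: cid.
pose x y := col_mx (vf_in_chart c K y) (s_of (cinv c y)).
pose rhs y : EF := (a (I y).1, b (I y).1 *m (I y).2).
have Lx y : W y -> LL y (x y) = rhs y.
  move=> /frameW[w [yw cw fw]]; rewrite -[LL y _]/(L y _) /L (dIE _ _ _ yw cw fw).
  have Iy : I y = cmap fd (i w) by rewrite /I /= yw cmapK.
  have wy : cinv c y = w by rewrite yw cmapK.
  rewrite /x col_mxKu col_mxKd wy Iy -muE// yw vf_in_chartE//.
  have -> : tchange c (chart_at w) w (tchange (chart_at w) c w (K w)) = K w.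
    by apply: tchangeK => //; [exact: chart_at_atlas|exact: chart_at_dom].
  by rewrite -linearD -s_ofP ab// /rhs -yw Iy.
have cI1 : Ck r W (fun y => (I y).1).
  apply: (Ck_compl (L := fst)) (sW r) => //; exact: findim_linear_continuous.
have cI2 : Ck r W (fun y => (I y).2).
  apply: (Ck_compl (L := snd)) (sW r) => //; exact: findim_linear_continuous.
have I1 y : W y -> (cmap d @` cdom d) (I y).1.
  move=> /frameW[w [yw cw fw]]; exists (fbase (i w)) => //.
  by rewrite /I /= yw cmapK.
have cx : Ck r W x.
  apply: (@Ck_solve_lin R _ _ _ r W _ LL rhs x oW) => //.
    move=> l; apply: Ck_add => //.
      have := (sW r.+1).2 (usubmx (delta_mx l 0)); apply: Ck_ext => // y Wy.
      by rewrite deriveE//; exact: ((sW 1%N).1 _ Wy).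
    apply: Ck_pair => //; first exact: Ck_cst.
    by apply: Ck_mulmx => //; exact: Ck_cst.
  apply: Ck_pair => //; first exact: (Ck_comp oW I1 cI1 (sa r)).
  by apply: Ck_mulmx => //; exact: (Ck_comp oW I1 cI1 (sb r)).
have : Ck r W (fun y => usubmx (x y)).
  apply: (Ck_compl (L := usubmx)) cx => //; exact: findim_linear_continuous.
by apply: Ck_ext => // y _; rewrite /x col_mxKu.
Qed.
End KosmannLift.

(** * Existence, smoothness, invariance and uniqueness of the lift *)

Theorem corollary4p18 (R : realType) (m k p n q : nat)
  (M : manifoldType 'cV[R]_m)
  (G : lieGroupType 'cV[R]_k) (j : G -> 'M[R]_m) (mm : {vspace 'M[R]_m})
  (P : manifoldType 'cV[R]_p) (pi : P -> M) (act : P -> G -> P)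
  (i : P -> frame M)
  (Gam : lieGroupType 'cV[R]_n) (rho : Gam -> G)
  (Pt : manifoldType 'cV[R]_q) (pit : Pt -> M) (actt : Pt -> Gam -> Pt)
  (zeta : Pt -> P) :
  classical_G_structure j mm pi act i ->
  central_hom rho ->
  principal_bundle pit actt ->
  gamma_structure rho pit actt pi act zeta ->
  forall xi : M -> 'cV[R]_m, smooth_vf xi ->
  exists xit : Pt -> 'cV[R]_q,
    [/\ smooth_vf xit, projects zeta xit (kosmann_lift mm i xi),
        invariant_vf actt xit &
        forall X : Pt -> 'cV[R]_q, smooth_vf X ->
          projects zeta X (kosmann_lift mm i xi) -> X = xit].
Proof.
move=> cG cr Bt gz xi _.
have B : principal_bundle pi act by case: cG.
pose K := kosmann_lift mm i xi.
have dz u := gamma_mderivable gz u.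
have zinj u : injective (mdiff zeta u) by exact: (mdiff_gamma_inj B Bt cr gz).
have zsurj u : exists v, mdiff zeta u v = K (zeta u).
  exact: (mdiff_gamma_surj B Bt cr gz).
pose xit u := projT1 (cid (zsurj u)).
have xitP : projects zeta xit K by move=> u; rewrite /xit; case: cid.
exists xit; split=> //.
- move=> c ac r; apply: Ck_local => _ [u cu <-].
  pose d : chart 'cV[R]_p P := chart_at (zeta u).
  have ad : atlas d by exact: chart_at_atlas.
  have dzu : cdom d (zeta u) by exact: chart_at_dom.
  have [sz _ _] := gz.
  have [W [oW Wu Wc Wd sW]] := msmooth_at_chart (sz u) ac ad cu dzu.
  exists W => //; pose Z := cmap d \o zeta \o cinv c.
  have {}sW : smooth_on W Z by exact: sW.
  have WP y : W y -> exists w, [/\ y = cmap c w, cdom c w & cdom d (zeta w)].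
    move=> Wy; have [w cw wy] := Wc _ Wy; exists w; split=> //.
    by have := Wd _ Wy; rewrite -wy cmapK.
  have dZE w v : cdom c w -> cdom d (zeta w) -> 'd Z (cmap c w) v =
      tchange (chart_at (zeta w)) d (zeta w) (mdiff zeta w (tchange c (chart_at w) w v)).
    by move=> cw dw; exact: (mdiff_chart_tangent (dz w) ac ad cw dw).
  (* The system says that the differential of zeta in charts sends the unknown to the Kosmann lift,
     evaluated along zeta. *)
  apply: (@Ck_solve_lin R _ _ _ r W _ (fun y => 'd Z y) (fun y => vf_in_chart d K (Z y)) _ oW).
  + move=> l; have := (sW r.+1).2 (delta_mx l 0); apply: Ck_ext => // y Wy.
    by rewrite deriveE//; exact: ((sW 1%N).1 _ Wy).
  + have KS := kosmann_lift_smooth cG xi ad r.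
    apply: (Ck_comp oW _ (sW r) KS).
    by move=> y /WP[w [-> cw dw]]; exists (zeta w) => //; rewrite /Z /= cmapK.
  + move=> y /WP[w [-> cw dw]] v; rewrite dZE// => v0.
    have z0 := tchange_eq0 (chart_at_atlas (zeta w)) ad (chart_at_dom (zeta w)) dw v0.
    have t0 : tchange c (chart_at w) w v = 0 by apply: (zinj w); rewrite z0 mdiff0.
    exact: (tchange_eq0 ac (chart_at_atlas w) cw (chart_at_dom w) t0).
  + move=> y /WP[w [-> cw dw]]; rewrite dZE// vf_in_chartE//.
    have -> : tchange c (chart_at w) w (tchange (chart_at w) c w (xit w)) = xit w.
      by apply: tchangeK => //; [exact: chart_at_atlas|exact: chart_at_dom].
    have -> : Z (cmap c w) = cmap d (zeta w) by rewrite /Z /= cmapK.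
    by rewrite (xitP w) (vf_in_chartE _ dw).
(* Both sides have the same image under the injective tangent map of zeta, since the Kosmann lift is
   invariant under [rho a]. *)
- move=> a u; apply: (zinj (actt u a)); rewrite xitP.
  have [_ _ zact] := gz.
  have [_ e1] := mdiff_comp (bundle_translation_mderivable Bt a u) (dz _).
  rewrite -e1; have -> : zeta \o actt ^~ a = (act ^~ (rho a)) \o zeta.
    by apply/funext => v; exact: zact.
  have [_ ->] := mdiff_comp (dz u) (bundle_translation_mderivable B (rho a) _).
  by rewrite xitP zact; exact: (kosmann_lift_invariant cG).
- move=> X _ XP; apply/funext => u; apply: (zinj u).
  by rewrite (XP u) (xitP u).
Qed.
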